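(* Let $(M,I(M))$ be a pi-space of finite rank. Then $\mathcal{L}(M,I(M))$ is Cohen–Macaulay of dimension $\mathrm{rk}_{I(M)}(M)$.
   Context: A pi-space is a pair $(M,I(M))$ with $M$ a non-empty set and $I(M)$ a non-empty family of subsets of $M$ (independent sets) such that (I1) subsets of independent sets are independent, and (I2) if $\sigma,\tau\in I(M)$ are finite with $|\sigma|>|\tau|$, there is $x\in\sigma\setminus\tau$ with $\tau\cup\{x\}\in I(M)$. The rank $\mathrm{rk}_{I(M)}(M)$ is the supremum of sizes of independent sets. A flat is a subset $F\subseteq M$ such that for every $x\in M\setminus F$ and independent $\sigma\subseteq F$, $\sigma\cup\{x\}\in I(M)$; $\mathcal{L}(M,I(M))$ is the poset of flats under inclusion, a bounded poset with maximum $M$ and minimum the set of loops $\{x\in M:\{x\}\notin I(M)\}$. A bounded poset is Cohen–Macaulay if the order complex of its proper part (minimum and maximum removed) is homotopically Cohen–Macaulay, i.e. every closed interval $[a,b]$ has open interval $(a,b)$ whose order complex is spherical (($\dim-1$)-connected). Here ''of dimension $\mathrm{rk}_{I(M)}(M)$'' refers to the length of maximal chains of the bounded lattice; the order complex of its proper part has dimension $\mathrm{rk}_{I(M)}(M)-2$. *)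

(* Defs.v *)
From HB Require Import structures.
From mathcomp Require Import all_boot all_order all_algebra finmap.
From mathcomp Require Import all_classical all_reals all_analysis.

Set Implicit Arguments.
Unset Strict Implicit.
Unset Printing Implicit Defensive.

Import Order.TTheory GRing.Theory Num.Theory.
Import numFieldNormedType.Exports.
Local Open Scope classical_set_scope.
Local Open Scope card_scope.
Local Open Scope ring_scope.

(* The ground set may be infinite. In [indep_exchange], [s #= `I_m] says both
   that [s] is finite and that it has exactly [m] elements. *)
Record piSpace := PiSpace {
  carrier :> Type ;
  indep : set (set carrier) ;
  carrier_inhabited : inhabited carrier ;
  indep_nonempty : indep !=set0 ;
  indep_subset : forall s t, indep s -> t `<=` s -> indep t ;
  indep_exchange : forall (s t : set carrier) (m n : nat),
    indep s -> indep t -> s #= `I_m -> t #= `I_n -> (n < m)%N ->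
    exists x, (s `\` t) x /\ indep (t `|` [set x]) }.

Arguments indep : clear implicits.
Arguments indep_nonempty : clear implicits.

(* The least upper bound of the sizes of the independent sets is the (finite)
   number [r]; an infinite set never satisfies [s #<= `I_n]. *)
Definition has_rank (X : piSpace) (r : nat) : Prop :=
  (forall s, indep X s -> s #<= `I_r) /\
  (forall n : nat, (forall s, indep X s -> s #<= `I_n) -> (r <= n)%N).

Definition is_flat (X : piSpace) (F : set X) : Prop :=
  forall (x : X) (s : set X),
    ~ F x -> indep X s -> s `<=` F -> indep X (s `|` [set x]).

Definition loops (X : piSpace) : set X := [set x | ~ indep X [set x]].

Arguments loops : clear implicits.

Record flats (X : piSpace) := Flat {
  flat_set :> set X ;
  flatP : is_flat flat_set }.

Lemma flat_inj (X : piSpace) (F G : flats X) :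
  flat_set F = flat_set G -> F = G.
Proof.
case: F G => [F hF] [G hG] /= FG; rewrite FG in hF *.
by rewrite (Prop_irrelevance hF hG).
Qed.

HB.instance Definition _ (X : piSpace) := gen_eqMixin (flats X).
HB.instance Definition _ (X : piSpace) := gen_choiceMixin (flats X).

Definition flat_le (X : piSpace) (F G : flats X) : bool :=
  `[< flat_set F `<=` flat_set G >].

Lemma flat_le_refl (X : piSpace) : reflexive (@flat_le X).
Proof. by move=> F; apply/asboolP. Qed.

Lemma flat_le_anti (X : piSpace) : antisymmetric (@flat_le X).
Proof.
move=> F G /andP[/asboolP FG /asboolP GF].
by apply: flat_inj; apply/seteqP.
Qed.

Lemma flat_le_trans (X : piSpace) : transitive (@flat_le X).
Proof.
move=> G F H /asboolP FG /asboolP GH; apply/asboolP.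
exact: subset_trans GH.
Qed.

Fact flats_display : Order.disp_t. Proof. by []. Qed.

HB.instance Definition _ (X : piSpace) :=
  Order.Le_isPOrder.Build flats_display (flats X)
    (@flat_le_refl X) (@flat_le_anti X) (@flat_le_trans X).

Lemma setT_flat (X : piSpace) : is_flat [set: X].
Proof. by move=> x s /(_ I). Qed.

Lemma loops_flat (X : piSpace) : is_flat (loops X).
Proof.
move=> x s /contrapT xI sI sL.
suff -> : s = set0 by rewrite set0U.
rewrite -subset0 => y sy; apply: (sL y sy).
by apply: indep_subset sI _ => _ ->.
Qed.

Lemma loops_sub (X : piSpace) (F : flats X) : loops X `<=` F.
Proof.
move=> x xL; apply: contrapT => xF; apply: xL.
rewrite -(set0U [set x]); apply: (flatP xF) => //.
by have [s sI] := indep_nonempty X; apply: indep_subset sI _.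
Qed.

Lemma flats_le_bot (X : piSpace) (F : flats X) :
  (Flat (@loops_flat X) <= F)%O.
Proof. by apply/asboolP; exact: loops_sub. Qed.

Lemma flats_le_top (X : piSpace) (F : flats X) :
  (F <= Flat (@setT_flat X))%O.
Proof. exact/asboolP. Qed.

HB.instance Definition _ (X : piSpace) :=
  Order.hasBottom.Build flats_display (flats X) (@flats_le_bot X).
HB.instance Definition _ (X : piSpace) :=
  Order.hasTop.Build flats_display (flats X) (@flats_le_top X).

Record simplicialComplex (V : choiceType) := SimplicialComplex {
  faces : set {fset V} ;
  faces_closed : forall s t : {fset V}, faces s -> (t `<=` s)%fset -> faces t }.

(* The empty set is a face, of dimension -1. *)
Definition has_dim (V : choiceType) (K : simplicialComplex V) (n : int) : Prop :=
  (forall s : {fset V}, faces K s -> (#|` s|)%:Z <= n + 1) /\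
  (exists2 s : {fset V}, faces K s & (#|` s|)%:Z = n + 1).

Section Realization.
Context (R : realType) (V : choiceType).

(* The closed simplex spanned by [s], in barycentric coordinates. *)
Definition simplex (s : {fset V}) : set (V -> R) :=
  [set w | [/\ forall v, 0 <= w v,
               forall v, v \notin s -> w v = 0
             & \sum_(v <- s) w v = 1]].

Record realization (K : simplicialComplex V) := Realization {
  coord :> V -> R ;
  coordP : (\bigcup_(s in faces K) simplex s) coord }.

Context (K : simplicialComplex V).

HB.instance Definition _ := gen_eqMixin (realization K).
HB.instance Definition _ := gen_choiceMixin (realization K).

(* The weak topology: a set is open if its trace on every closed simplex is
   open for the Euclidean topology of that simplex, here given by the maximum
   of the differences of the finitely many relevant coordinates. *)
Definition realization_open (U : set (realization K)) : Prop :=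
  forall s : {fset V}, faces K s -> forall p : realization K, simplex s p -> U p ->
    exists2 e : R, 0 < e &
      forall q : realization K, simplex s q ->
        (forall v, v \in s -> `|p v - q v| < e) -> U q.

Lemma realization_openT : realization_open setT.
Proof. by move=> s _ p _ _; exists 1. Qed.

Lemma realization_openI (A B : set (realization K)) :
  realization_open A -> realization_open B -> realization_open (A `&` B).
Proof.
move=> oA oB s Ks p sp [Ap Bp].
have [e e0 he] := oA s Ks p sp Ap; have [d d0 hd] := oB s Ks p sp Bp.
exists (Order.min e d); first by rewrite lt_min e0.
move=> q sq pq; split.
- by apply: he => // v /pq; rewrite lt_min => /andP[].
- by apply: hd => // v /pq; rewrite lt_min => /andP[].
Qed.

Lemma realization_open_bigU (I : Type) (f : I -> set (realization K)) :
  (forall i, realization_open (f i)) -> realization_open (\bigcup_i f i).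
Proof.
move=> of_ s Ks p sp [i _ fip]; have [e e0 he] := of_ i s Ks p sp fip.
by exists e => // q sq pq; exists i => //; exact: he.
Qed.

HB.instance Definition _ :=
  isOpenTopological.Build (realization K)
    realization_openT realization_openI realization_open_bigU.

End Realization.

Definition sphere (R : realType) (d : nat) : set 'rV[R]_d :=
  [set x | \sum_(i < d) x 0 i ^+ 2 = 1].

Definition disk (R : realType) (d : nat) : set 'rV[R]_d :=
  [set x | \sum_(i < d) x 0 i ^+ 2 <= 1].

(* Every space is [n]-connected for [n <= -2], and the (-1)-connected spaces
   are the non-empty ones. As the unit sphere of R^(k+1) has dimension [k], the
   case [k = 0] below is path-connectedness. *)
Definition n_connected (R : realType) (n : int) (T : topologicalType) : Prop :=
  (-1 <= n -> inhabited T) /\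
  forall k : nat, k%:Z <= n ->
    forall f : 'rV[R]_k.+1 -> T, {within @sphere R k.+1, continuous f} ->
    exists2 g : 'rV[R]_k.+1 -> T,
      {within @disk R k.+1, continuous g} &
      forall x, @sphere R k.+1 x -> g x = f x.

Definition spherical (R : realType) (V : choiceType)
    (K : simplicialComplex V) : Prop :=
  exists2 n : int, has_dim K n & n_connected R (n - 1) (realization R K).

Section Posets.
Context (d : Order.disp_t).

Definition finite_chains (P : porderType d) (A : set P) : set {fset P} :=
  [set s | (forall x, x \in s -> A x) /\
           (forall x y, x \in s -> y \in s -> (x >=< y)%O)].

Lemma finite_chains_closed (P : porderType d) (A : set P) (s t : {fset P}) :
  finite_chains A s -> (t `<=` s)%fset -> finite_chains A t.
Proof.
move=> [sA sC] /fsubsetP ts; split=> [x /ts /sA //|x y /ts xs /ts ys].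
exact: sC.
Qed.

Definition order_complex (P : porderType d) (A : set P) : simplicialComplex P :=
  SimplicialComplex (@finite_chains_closed P A).

Definition proper_part (P : tbPOrderType d) : set P :=
  [set x | (\bot < x < \top)%O].

Definition cohen_macaulay (R : realType) (P : tbPOrderType d) : Prop :=
  forall a b : P, (a <= b)%O ->
    spherical R (order_complex [set x : P | (a < x < b)%O]).

Definition maximal_chain (P : porderType d) (C : set P) : Prop :=
  total_on C (fun x y : P => (x <= y)%O) /\
  forall D : set P, total_on D (fun x y : P => (x <= y)%O) ->
    C `<=` D -> D `<=` C.

(* A chain with [n + 1] elements has length [n]. *)
Definition maximal_chains_length (P : porderType d) (n : nat) : Prop :=
  forall C : set P, maximal_chain C -> C #= `I_n.+1.

(* "Cohen-Macaulay of dimension n": the dimension is the length of the maximal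
   chains of the whole bounded poset, so that the order complex of the proper
   part has dimension n - 2. When n = 0 the poset is a point and that complex
   is {emptyset}, of dimension -1, whence the guard. *)
Definition cohen_macaulay_of_dim (R : realType) (P : tbPOrderType d)
    (n : nat) : Prop :=
  [/\ cohen_macaulay R P,
      maximal_chains_length P n
    & (0 < n)%N -> has_dim (order_complex (@proper_part P)) (n%:Z - 2)].

End Posets.

(* Main.v *)
(* The proof is by induction on the length of the interval (A, B). Choose
   a point x of B outside A, let a be the flat spanned by A and x, and call
   "apexes" the flats of (A, B) that are covered by B and do not contain x.
   Without the apexes the order complex is contractible, by
   F <= F \/ a >= a. Distinct apexes are incomparable, and the link of an apex
   H is the order complex of (A, H), whose connectivity is known by induction.
   Hence the order complex of (A, B) is a contractible complex to which cones
   over subcomplexes of connectivity one less are attached.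
   That this raises the connectivity is proved without homotopy groups: a map
   from the boundary of a cube is subdivided until every small cube is mapped
   either off the apexes or into the open star of one apex, and then it is
   homotoped off the apexes cell by cell. *)
Require Import Defs.
From mathcomp Require Import all_boot all_order all_algebra finmap.
From mathcomp Require Import all_classical all_reals all_analysis.
From mathcomp Require Import lra zify.

Set Implicit Arguments.
Unset Strict Implicit.
Unset Printing Implicit Defensive.

Import Order.TTheory GRing.Theory Num.Theory.
Import numFieldNormedType.Exports.
Local Open Scope classical_set_scope.
Local Open Scope ring_scope.

(** * Continuity on a subset *)

(** Since the ground set may be infinite, the order complexes carry a genuinely weak topology, and
    infinitely many cones may be attached at once. Compactness of the sphere removes the difficulty:
    a map from it into a realization has only finitely many nonzero coordinates, and for such maps
    coordinatewise continuity is enough. All homotopies are therefore formulas on functions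
    [V -> R], mostly straight lines. The apexes are exactly the elements of the open interval that
    are sent to [B] when [x] is adjoined: adjoining a point raises the rank by at most one and fixes
    the flats that contain it. This is why their removal makes the contraction possible. The
    delicate point is a count of dimensions. The base of a cone is one step less connected than the
    result should be, while the prism over a top cell of the subdivided boundary has the full
    dimension [m]. Such a top cell has no coface but itself, so its prism is filled either off the
    apexes or in a contractible open star, never in the base of a cone. *)

Lemma within_continuous_comp (E F G : topologicalType) (A : set E) (B : set F)
    (f : E -> F) (g : F -> G) :
  {within A, continuous f} -> (forall x, A x -> B (f x)) ->
  {within B, continuous g} -> {within A, continuous (g \o f)}.
Proof.
move=> /subspace_continuousP cf AB /subspace_continuousP cg.
apply/subspace_continuousP => x Ax U gU.
have /= := cf x Ax _ (cg (f x) (AB x Ax) U gU).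
by rewrite /nbhs /= /within /=; apply: filterS => y yB Ay; apply: yB => //;
    exact: AB.
Qed.

Lemma eq_within_continuous (E F : topologicalType) (A : set E) (f g : E -> F) :
  (forall x, A x -> f x = g x) ->
  {within A, continuous f} -> {within A, continuous g}.
Proof. by move=> fg; apply: subspace_eq_continuous => x;
    rewrite inE => /fg. Qed.

Lemma continuous_row (R : realType) (E : topologicalType) (A : set E) n
    (f : E -> 'rV[R]_n) :
  (forall i, {within A, continuous (fun x => f x 0 i)}) ->
      {within A, continuous f}.
Proof.
move=> cf; apply/subspace_continuousP => x Ax.
move=> U [P /= PM PU].
have : within A (nbhs x) (\bigcap_(i in [set` [fset i in 'I_n]%fset])
    [set y | P 0 i (f y 0 i)]).
  apply: filter_bigI => i _.
  by move/subspace_continuousP: (cf i) => /(_ x Ax); apply; exact: PM.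
apply: filterS => y yP; apply: PU => i j; rewrite ord1.
by apply: yP; rewrite /= !inE.
Qed.

Lemma within_continuous_pair (E F G : topologicalType) (A : set E)
    (f : E -> F) (g : E -> G) :
  {within A, continuous f} -> {within A, continuous g} ->
  {within A, continuous (fun x => (f x, g x))}.
Proof. by move=> cf cg x; apply: cvg_pair; [exact: cf|exact: cg]. Qed.

Section RealValued.
Context (R : realType) (E : topologicalType) (A : set E).
Implicit Types f g : E -> R.

Lemma within_continuous_cst (c : R) : {within A, continuous (fun=> c)}.
Proof. by apply: continuous_subspaceT; exact: cst_continuous. Qed.

Lemma within_continuousD f g : {within A, continuous f} ->
  {within A, continuous g} -> {within A, continuous (fun x => f x + g x)}.
Proof. by move=> cf cg x; apply: cvgD; [exact: cf|exact: cg]. Qed.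

Lemma within_continuousB f g : {within A, continuous f} ->
  {within A, continuous g} -> {within A, continuous (fun x => f x - g x)}.
Proof. by move=> cf cg x; apply: cvgB; [exact: cf|exact: cg]. Qed.

Lemma within_continuousM f g : {within A, continuous f} ->
  {within A, continuous g} -> {within A, continuous (fun x => f x * g x)}.
Proof. by move=> cf cg x; apply: cvgM; [exact: cf|exact: cg]. Qed.

Lemma within_continuousV f : (forall x, A x -> f x != 0) ->
  {within A, continuous f} -> {within A, continuous (fun x => (f x)^-1)}.
Proof.
move=> f0 /subspace_continuousP cf; apply/subspace_continuousP => x Ax.
by apply: cvgV; [exact: f0|exact: cf].
Qed.

Lemma within_continuous_min f g : {within A, continuous f} ->
  {within A, continuous g} ->
  {within A, continuous (fun x => Num.min (f x) (g x))}.
Proof. by move=> cf cg x; apply: continuous_min; [exact: cf|exact: cg]. Qed.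

Lemma within_continuous_max f g : {within A, continuous f} ->
  {within A, continuous g} ->
  {within A, continuous (fun x => Num.max (f x) (g x))}.
Proof. by move=> cf cg x; apply: continuous_max; [exact: cf|exact: cg]. Qed.

Lemma within_continuous_sum (I : Type) (s : seq I) (P : pred I) (f : I -> E ->
    R) :
  (forall i, {within A, continuous (f i)}) ->
  {within A, continuous (fun x => \sum_(i <- s | P i) f i x)}.
Proof.
move=> cf; elim: s => [|i s IH].
  apply: (@eq_within_continuous _ _ _ (fun=> 0)) => [x _|].
    by rewrite big_nil.
  exact: within_continuous_cst.
apply: (@eq_within_continuous _ _ _ (fun x => (if P i then f i x else 0) +
    \sum_(j <- s | P j) f j x)) => [x _|].
  by rewrite big_cons; case: (P i); rewrite ?add0r.
apply: within_continuousD => //; case: (P i) => //.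
exact: within_continuous_cst.
Qed.

End RealValued.

Lemma within_continuous_norm (R : realType) (V : normedModType R) (A : set V) :
  {within A, continuous (fun x : V => `|x|)}.
Proof. by apply: continuous_subspaceT; exact: norm_continuous. Qed.

Lemma within_continuousZ (R : realType) (E : topologicalType)
    (V : normedModType R) (A : set E) (a : E -> R) (f : E -> V) :
  {within A, continuous a} -> {within A, continuous f} ->
  {within A, continuous (fun x => a x *: f x)}.
Proof. by move=> ca cf x; apply: cvgZ; [exact: ca|exact: cf]. Qed.

(** * Extension of maps from the boundary of a cube *)

Section FiniteSupport.
Context (R : realType) (V : choiceType).
Implicit Types (E F : topologicalType) (W : set (V -> R)).

(* As the domain is compact in the applications, these are exactly the
   continuous maps into a polyhedron with its weak topology. *)
Definition fcont E (D : set E) (g : E -> V -> R) : Prop :=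
  (exists S : {fset V}, forall x, D x -> forall v, v \notin S -> g x v = 0) /\
  (forall v, {within D, continuous (fun x => g x v)}).

Lemma fcont_comp E F (A : set E) (B : set F) (f : E -> F) g :
  {within A, continuous f} -> (forall x, A x -> B (f x)) -> fcont B g ->
  fcont A (g \o f).
Proof.
move=> cf AB [[S gS] cg]; split; first by exists S => x /AB; exact: gS.
by move=> v; exact: (within_continuous_comp cf AB (cg v)).
Qed.

Lemma eq_fcont E (A : set E) (f g : E -> V -> R) :
  (forall x, A x -> f x = g x) -> fcont A f -> fcont A g.
Proof.
move=> fg [[S fS] cf]; split.
  by exists S => x Ax v vS; rewrite -fg// fS.
by move=> v; apply: eq_within_continuous (cf v) => x /fg ->.
Qed.

Lemma fcontU E (A B : set E) g : closed A -> closed B ->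
  fcont A g -> fcont B g -> fcont (A `|` B) g.
Proof.
move=> cA cB [[S gS] cg] [[T gT] cg']; split.
  exists (S `|` T)%fset => x [Ax|Bx] v; rewrite inE => /norP[vS vT].
    exact: gS.
  exact: gT.
by move=> v; exact: withinU_continuous.
Qed.

Lemma fcont_cst E (A : set E) (S : {fset V}) w :
  (forall v, v \notin S -> w v = 0) -> fcont A (fun=> w).
Proof.
move=> wS; split; first by exists S => x _.
by move=> v; apply: continuous_subspaceT; exact: cst_continuous.
Qed.

Lemma fcontD E (A : set E) f g :
  fcont A f -> fcont A g -> fcont A (fun x v => f x v + g x v).
Proof.
move=> [[S fS] cf] [[T gT] cg]; split.
  exists (S `|` T)%fset => x Ax v; rewrite inE => /norP[vS vT].
  by rewrite fS ?gT ?addr0.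
by move=> v; apply: within_continuousD.
Qed.

Lemma fcontM E (A : set E) (a : E -> R) g :
  {within A, continuous a} -> fcont A g -> fcont A (fun x v => a x * g x v).
Proof.
move=> ca [[S gS] cg]; split.
  by exists S => x Ax v vS; rewrite gS ?mulr0.
by move=> v; apply: within_continuousM.
Qed.

Definition cube j : set 'rV[R]_j := [set x | `|x| <= 1].
Definition cube_bd j : set 'rV[R]_j := [set x | `|x| = 1].

Definition extends j W (f : 'rV[R]_j -> V -> R) : Prop :=
  exists g, [/\ fcont (@cube j) g, forall x, cube x -> W (g x) &
    forall x, cube_bd x -> g x = f x].

(* [j = 0] says that [W] is non-empty, and in general [ext i W] for all
   [i <= j] says that [W] is [(j - 1)]-connected. *)
Definition ext j W : Prop := forall f : 'rV[R]_j -> V -> R,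
  fcont (@cube_bd j) f -> (forall x, cube_bd x -> W (f x)) -> extends W f.

(** Homotopy extension by a collar: where the maximum norm lies between [1 / 2] and 1 the map runs
    through [H], time growing inwards from 0 to 1, and the half-size cube inside carries the
    extension of the end map. *)
Lemma extends_homotopy j W (H : 'rV[R]_j -> R -> V -> R) :
  fcont ((@cube_bd j `*` `[0, 1]) : set ('rV[R]_j * R)%type)
    (fun p => H p.1 p.2) ->
  (forall x t, cube_bd x -> 0 <= t <= 1 -> W (H x t)) ->
  extends W (H ^~ 1) -> extends W (H ^~ 0).
Proof.
move=> cH HW [g [cg gW gH]].
pose A : set 'rV[R]_j := [set x | 1 / 2 <= `|x| <= 1].
pose B : set 'rV[R]_j := [set x | `|x| <= 1 / 2].
pose h x := if 1 / 2 <= `|x| then H (`|x|^-1 *: x) (2 * (1 - `|x|))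
  else g (2%:R *: x).
have nx1 (x : 'rV[R]_j) : `|x| != 0 -> cube_bd (`|x|^-1 *: x).
  by move=> x0; rewrite /cube_bd /= normrZ normfV normr_id mulVf.
have half0 (x : 'rV[R]_j) : 1 / 2 <= `|x| -> `|x| != 0.
  by move=> x2; rewrite gt_eqF //; lra.
have clA : closed A.
  have -> : A = (fun x : 'rV[R]_j => `|x|) @^-1` `[1 / 2, 1].
    by apply/seteqP; split=> x; rewrite /A /= in_itv.
  by apply: (continuous_closedP _).1;
      [exact: norm_continuous|exact: itv_closed].
have clB : closed B.
  exact: (continuous_closedP _).1 (@norm_continuous _ _) _ (@closed_le R _).
have AB : @cube j = A `|` B.
  apply/seteqP; split=> x; rewrite /A /B /cube /=; last by move=> []; lra.
  move=> x1; case: (boolP (1 / 2 <= `|x|)) => h2; [left|right]; lra.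
have bdB x : B x -> h x = g (2%:R *: x).
  rewrite /h /B /= => Bx; case: ifPn => // hx.
  have x2 : `|x| = 1 / 2 by lra.
  have -> : 2 * (1 - `|x|) = 1 :> R by lra.
  have -> : `|x|^-1 = 2%:R :> R by rewrite x2 div1r invrK.
  by rewrite gH// /cube_bd /= normrZ x2 ger0_norm//; lra.
exists h; split.
- rewrite AB; apply: fcontU => //.
    have fA x : A x -> H (`|x|^-1 *: x) (2 * (1 - `|x|)) = h x.
      by rewrite /A /h /= => /andP[->].
    pose q (x : 'rV[R]_j) : ('rV[R]_j * R)%type :=
      (`|x|^-1 *: x, 2 * (1 - `|x|)).
    apply: (@eq_fcont _ _ ((fun p => H p.1 p.2) \o q)) => //.
    apply: fcont_comp cH; last first.
      move=> x /andP[x2 x1]; split; last by rewrite /= in_itv /=; lra.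
      exact/nx1/half0.
    apply: within_continuous_pair.
      apply: within_continuousZ; last by apply: continuous_subspaceT => x;
          exact: cvg_id.
      apply: within_continuousV; last exact: within_continuous_norm.
      by move=> x /andP[/half0].
    apply: within_continuousM; first exact: within_continuous_cst.
    apply: within_continuousB; first exact: within_continuous_cst.
    exact: within_continuous_norm.
  have fB x : B x -> g (2%:R *: x) = h x by move=> Bx; rewrite bdB.
  apply: (@eq_fcont _ _ (g \o (fun x : 'rV[R]_j => 2%:R *: x))) => //.
  apply: fcont_comp cg.
    apply: continuous_subspaceT => x; exact: scaler_continuous.
  by move=> x; rewrite /B /cube /= normrZ ger0_norm //; lra.
- move=> x; rewrite /cube /= => x1; rewrite /h; case: ifPn => x2.
    by apply: HW; [exact/nx1/half0|lra].
  by apply: gW; rewrite /cube /= normrZ ger0_norm //; lra.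
- move=> x; rewrite /cube_bd /= => x1; rewrite /h x1.
  have -> : 1 / 2 <= 1 :> R by lra.
  by rewrite invr1 scale1r subrr mulr0.
Qed.

End FiniteSupport.

(** * Cubical grids *)

Lemma rV_norm_le (R : realType) n (x : 'rV[R]_n) (c : R) : 0 <= c ->
  (`|x| <= c) <-> (forall i, `|x 0 i| <= c).
Proof.
move=> c0; rewrite /Num.norm /= mx_normrE; split=> [/bigmax_leP[_ xc] i|xc].
  exact: (xc (0, i) isT).
by apply/bigmax_leP; split=> // -[i j] _; rewrite ord1; exact: xc.
Qed.

Lemma rV_norm_coord (R : realType) n (x : 'rV[R]_n) :
  `|x| != 0 -> exists i, `|x 0 i| = `|x|.
Proof.
move=> x0; have [[i j] /= xij] := @mx_norm_neq0 _ _ _ x x0.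
by exists j; rewrite [RHS]xij ord1.
Qed.

Lemma rV_norm_eq (R : realType) n (x : 'rV[R]_n) (c : R) : 0 < c ->
  `|x| = c <-> (forall i, `|x 0 i| <= c) /\ (exists i, `|x 0 i| = c).
Proof.
move=> c0; split=> [xc|[xc [i xi]]].
  split; first by apply/(rV_norm_le _ (ltW c0)); rewrite xc.
  by rewrite -xc; apply: rV_norm_coord; rewrite xc gt_eqF.
apply/eqP; rewrite eq_le -{2}xi; apply/andP; split.
  exact/(rV_norm_le _ (ltW c0)).
exact: (rV_norm_le _ (normr_ge0 x)).1.
Qed.

Section Grid.
Context (R : realType) (M B : nat).

(* An even coordinate [2k] stands for the point [2k], an odd one [2k+1] for the
   interval [2k, 2k+2]. *)
Local Notation index := {ffun 'I_M -> 'I_B.+1}.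
Implicit Types y z : index.

Definition cell z : set 'rV[R]_M :=
  [set x | forall i, `|x 0 i - (z i)%:R| <= (odd (z i))%:R].

Definition free z : {set 'I_M} := [set i | odd (z i)].

Definition face y z := [forall i, (y i == z i) ||
  odd (z i) && ((y i == (z i).+1 :> nat) || ((y i).+1 == z i :> nat))].

Lemma face_refl z : face z z.
Proof. by apply/forallP => i; rewrite eqxx. Qed.

Lemma face_free y z : face y z -> free y \subset free z.
Proof.
move=> /forallP yz; apply/fintype.subsetP => i; rewrite !inE.
by have := yz i; case: eqP => [->//|_ /andP[->]].
Qed.

Lemma face_trans : transitive face.
Proof.
move=> y x z /forallP xy /forallP yz; apply/forallP => i.
by have := xy i; have := yz i; rewrite -!(inj_eq val_inj) /=; lia.
Qed.

(** The neighbours of an odd index are even, so a proper face loses at least one free direction. *)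
Lemma face_free_eq y z : face y z -> (#|free z| <= #|free y|)%N -> y = z.
Proof.
move=> yz zy; have /eqP fyz : free y == free z by rewrite eqEcard face_free.
apply/ffunP => i; move/forallP: yz => /(_ i); case: eqP => // _ /=.
move=> /andP[oz yz]; have : i \in free y by rewrite fyz inE.
by rewrite inE; lia.
Qed.

Lemma face_cell y z : face y z -> cell y `<=` cell z.
Proof.
move=> /forallP yz x xy i; have := xy i.
case/orP: (yz i) => [/eqP->//|/andP[oz yz']].
have oy : odd (y i) = false by lia.
rewrite oy oz /= normr_le0 => /eqP e; rewrite ler_distl.
have {e} -> : x 0 i = (y i)%:R by apply/eqP; rewrite -subr_eq0 e.
by case/orP: yz' => /eqP; [move=> ->|move=> <-]; rewrite -natr1; lra.
Qed.

(** The last hypothesis puts [x] in the relative interior of [z]. This is what confines the overlap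
    of a new cell with older ones to its boundary. *)
Lemma cell_inj_free y z x : cell y x -> cell z x ->
  (forall i, odd (z i) -> `|x 0 i - (z i)%:R| < 1) -> face z y.
Proof.
move=> xy xz zi; apply/forallP => i; rewrite -(inj_eq val_inj) /=.
have := xy i; have := xz i; have := zi i.
case oz: (odd (z i)) => /=; case oy: (odd (y i)) => /=.
- move=> /(_ isT); rewrite !ltr_distl !ler_distl => h1 _ h2.
  have : (y i)%:R < (z i).+2%:R :> R /\ (z i)%:R < (y i).+2%:R :> R.
    by rewrite -!natr1; split; lra.
  by rewrite !ltr_nat => -[]; lia.
- move=> /(_ isT); rewrite ltr_distl normr_le0 => h1 _ /eqP h2.
  have : (y i)%:R < (z i).+1%:R :> R /\ (z i)%:R < (y i).+1%:R :> R.
    by rewrite -!natr1; split; lra.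
  by rewrite !ltr_nat => -[]; lia.
- move=> _; rewrite normr_le0 => /eqP h1; rewrite ler_distl => h2.
  have : (y i)%:R <= (z i).+1%:R :> R /\ (z i)%:R <= (y i).+1%:R :> R.
    by rewrite -!natr1; split; lra.
  by rewrite !ler_nat => -[]; lia.
- move=> _; rewrite !normr_le0 !subr_eq0 => /eqP-> /eqP/eqP.
  by rewrite eqr_nat => ->.
Qed.

(** As [B] is even, the upper neighbour of an odd index is still at most [B], so both ends of an
    interval are indices. *)
Lemma cell_bd z x i : ~~ odd B -> cell z x -> odd (z i) ->
    `|x 0 i - (z i)%:R| = 1 ->
  exists y, [/\ face y z, y != z & cell y x].
Proof.
move=> B_even xz oz xi.
have zB : (z i < B)%N by have := ltn_ord (z i); lia.
have : exists2 k : 'I_B.+1, x 0 i = k%:R &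
    (k == (z i).+1 :> nat) || (k.+1 == z i :> nat).
  move/eqP: xi; rewrite eqr_norml subr_eq => /andP[/orP[]/eqP xi _].
    have kB : ((z i).+1 < B.+1)%N by [].
    by exists (Ordinal kB) => /=; rewrite ?eqxx// -natr1 xi addrC.
  have kB : ((z i).-1 < B.+1)%N by lia.
  exists (Ordinal kB) => /=; last by lia.
  have z1 : (z i)%:R = (z i).-1%:R + 1 :> R by rewrite natr1 prednK//; lia.
  by lra.
move=> [k xk kz]; exists [ffun j => if j == i then k else z j]; split.
- by apply/forallP => j; rewrite ffunE; have [->|_] := eqVneq j i;
    rewrite ?eqxx// oz kz orbT.
- by apply/eqP => /ffunP/(_ i); rewrite ffunE eqxx => kzi; move: kz;
    rewrite kzi (ltn_eqF (ltnSn _)) (gtn_eqF (ltnSn _)).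
- move=> j; rewrite ffunE; have [->|_] := eqVneq j i; last exact: xz.
  by rewrite xk subrr normr0.
Qed.

Lemma closed_cell z : closed (cell z).
Proof.
pose c i : R := (odd (z i))%:R.
have -> : cell z = \bigcap_i (fun x : 'rV[R]_M => x 0 i) @^-1`
    `[(z i)%:R - c i, (z i)%:R + c i].
  apply/seteqP; split=> x xz i.
    by move=> _; rewrite /= in_itv /= -ler_distl; exact: xz.
  by have := xz i I; rewrite /= in_itv /= -ler_distl.
apply: closed_bigI => i _; apply: preimage_closed => [x _|].
  exact: (@coord_continuous R 1 M 0 i).
exact: itv_closed.
Qed.

Definition cell_proj z (x : 'rV[R]_M) : 'rV[R]_#|free z| :=
  \row_k (x 0 (enum_val k) - (z (enum_val k))%:R).

(** The sum has one term when [i] is free and none otherwise, which avoids inverting [enum_val]. *)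
Definition cell_emb z (u : 'rV[R]_#|free z|) : 'rV[R]_M :=
  \row_i ((z i)%:R + \sum_(k | enum_val k == i) u 0 k).

Arguments cell_emb z u : clear implicits.

Lemma cell_emb_free z u k : cell_emb z u 0 (enum_val k) =
    (z (enum_val k))%:R + u 0 k.
Proof.
by rewrite mxE; congr (_ + _); rewrite (big_pred1 k)// => k';
    rewrite (inj_eq enum_val_inj).
Qed.

Lemma cell_emb_fixed z u i : i \notin free z -> cell_emb z u 0 i = (z i)%:R.
Proof.
move=> iz; rewrite mxE big_pred0 ?addr0// => k.
by apply: contraNF iz => /eqP <-; exact: enum_valP.
Qed.

Lemma cell_embK z x : cell z x -> cell_emb z (cell_proj z x) = x.
Proof.
move=> xz; apply/rowP => i; have [iz|iz] := boolP (i \in free z).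
  by rewrite -(enum_rankK_in iz iz) cell_emb_free mxE addrC subrK.
rewrite cell_emb_fixed//; have := xz i; move: iz; rewrite inE => /negbTE->.
by rewrite normr_le0 subr_eq0 => /eqP.
Qed.

Lemma cell_emb_cell z u : `|u| <= 1 -> cell z (cell_emb z u).
Proof.
move=> /rV_norm_le u1 i; have [iz|iz] := boolP (i \in free z).
  move: (iz); rewrite inE => ->;
      rewrite -(enum_rankK_in iz iz) cell_emb_free addrC addKr.
  exact: u1.
by rewrite cell_emb_fixed// subrr normr0 ler0n.
Qed.

Lemma continuous_cell_proj z A : {within A, continuous (cell_proj z)}.
Proof.
apply: continuous_row => k.
apply: (@eq_within_continuous _ _ _
    (fun x : 'rV[R]_M => x 0 (enum_val k) - (z (enum_val k))%:R)).
  by move=> x _; rewrite mxE.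
apply: within_continuousB; last exact: within_continuous_cst.
by apply: continuous_subspaceT => x; exact: coord_continuous.
Qed.

Lemma continuous_cell_emb z A : {within A, continuous (cell_emb z)}.
Proof.
apply: continuous_row => i.
apply: (@eq_within_continuous _ _ _
    (fun u : 'rV[R]_#|free z| => (z i)%:R + \sum_(k | enum_val k == i) u 0 k)).
  by move=> x _; rewrite mxE.
apply: within_continuousD; first exact: within_continuous_cst.
apply: within_continuous_sum => k.
by apply: continuous_subspaceT => x; exact: coord_continuous.
Qed.

Lemma cell_proj_cube z x : cell z x -> cube (cell_proj z x).
Proof.
move=> xz; apply/rV_norm_le => // k; rewrite mxE.
by have := xz (enum_val k); have := enum_valP k; rewrite inE => ->.
Qed.

Lemma cell_proj_bd z x i : cell z x -> odd (z i) -> `|x 0 i - (z i)%:R| = 1 ->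
  cube_bd (cell_proj z x).
Proof.
move=> xz oz xi; apply/rV_norm_eq => //; split.
  by apply/rV_norm_le => //; exact: cell_proj_cube.
have iz : i \in free z by rewrite inE.
by exists (enum_rank_in iz i); rewrite mxE enum_rankK_in.
Qed.

Lemma cell_emb_bd z u : cube_bd u ->
  exists2 i, odd (z i) & `|cell_emb z u 0 i - (z i)%:R| = 1.
Proof.
move=> /rV_norm_eq[]// _ [k uk]; exists (enum_val k).
  by have := enum_valP k; rewrite inE.
by rewrite cell_emb_free addrC addKr.
Qed.

End Grid.

(** * Extension of maps along a carrier *)

Section Carrier.
Context (R : realType) (V : choiceType) (M B : nat).
Hypothesis B_even : ~~ odd B.
Local Notation index := {ffun 'I_M -> 'I_B.+1}.
Implicit Types (y z : index) (G : {set index}).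

Definition cells G : set 'rV[R]_M := \bigcup_(z in [set` G]) @cell R M B z.

Lemma closed_cells G : closed (cells G).
Proof.
apply: closed_bigcup; first exact: finite_finset.
by move=> z _; exact: closed_cell.
Qed.

(** The last two hypotheses say that [A] meets the cell exactly in its boundary, with values in [W]
    there; the cell is then filled through its identification with a standard cube. *)
Lemma cell_extension (A : set 'rV[R]_M) z (W : set (V -> R)) h :
  closed A -> fcont A h -> ext #|free z| W ->
  (forall x i, cell z x -> odd (z i) -> `|x 0 i - (z i)%:R| = 1 ->
      A x /\ W (h x)) ->
  (forall x, cell z x -> A x ->
      exists2 i, odd (z i) & `|x 0 i - (z i)%:R| = 1) ->
  exists h', [/\ fcont (A `|` cell z) h', forall x, cell z x -> W (h' x) &
    forall x, A x -> h' x = h x].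
Proof.
move=> cA ch extW bdA Abd.
have embA (u : 'rV[R]_#|free z|) : cube_bd u ->
    A (cell_emb u) /\ W (h (cell_emb u)).
  move=> u1; have [i oz iz] := cell_emb_bd u1.
  by apply: (bdA _ i) => //; apply: cell_emb_cell; rewrite u1.
have [||g [cg gW gh]] := extW (h \o @cell_emb R M B z).
- apply: fcont_comp ch; first exact: continuous_cell_emb.
  by move=> u /embA[].
- by move=> u /embA[].
pose h' x := if x \in cell z then g (cell_proj z x) else h x.
have h'z x : cell z x -> h' x = g (cell_proj z x).
  by move=> xz; rewrite /h' ifT// inE.
have h'A x : A x -> h' x = h x.
  rewrite /h'; case: ifPn => // /set_mem xz Ax.
  have [i oz xi] := Abd x xz Ax.
  rewrite gh; last exact: (cell_proj_bd xz oz xi).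
  by rewrite /= cell_embK.
exists h'; split => //.
- apply: fcontU => //; first exact: closed_cell.
    by apply: eq_fcont ch => x /h'A ->.
  apply: (@eq_fcont _ _ _ _ (g \o cell_proj z)) => [x /h'z ->//|].
  apply: fcont_comp cg; first exact: continuous_cell_proj.
  by move=> x; exact: cell_proj_cube.
- by move=> x xz; rewrite h'z//; apply/gW/cell_proj_cube.
Qed.

(** A carrier argument: the cells outside [G0] are filled one at a time, and monotonicity of [W] on
    faces keeps the boundary values of [z] in [W z]. *)
Lemma carrier_extension G G0 (W : index -> set (V -> R)) h0 :
  G0 \subset G ->
  (forall y z, z \in G -> face y z -> y \in G) ->
  (forall y z, z \in G0 -> face y z -> y \in G0) ->
  (forall y z, z \in G -> face y z -> W y `<=` W z) ->
  (forall z, z \in G -> z \notin G0 -> ext #|free z| (W z)) ->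
  fcont (cells G0) h0 ->
  (forall z x, z \in G0 -> cell z x -> W z (h0 x)) ->
  exists h, [/\ fcont (cells G) h,
    forall z x, z \in G -> cell z x -> W z (h x) &
    forall x, cells G0 x -> h x = h0 x].
Proof.
move=> + Gf + Wf.
have [k] := ubnP #|G :\: G0|; elim: k => // k IH in G0 h0 *.
rewrite ltnS => Gk G0G G0f eW ch0 h0W.
have [/eqP|GG0] := eqVneq (G :\: G0) finset.set0.
  rewrite finset.setD_eq0 => GG0; have e : G = G0 by apply/eqP;
      rewrite finset.eqEsubset GG0.
  by exists h0; rewrite e; split.
have /set0Pn[z1 z1G] := GG0.
(* Least dimension ensures that all proper faces of [z] are already in [G0]. *)
have [z + zmin] : exists2 z, z \in G :\: G0 &
    forall y, y \in G :\: G0 -> (#|free z| <= #|free y|)%N.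
  by case: (arg_minnP (fun z => #|free z|) z1G) => z zG zmin; exists z.
rewrite inE => /andP[zG0 zG].
have facesG0 y : face y z -> y != z -> y \in G0.
  move=> yz yz'; apply: contraNT yz' => yG0; apply/eqP;
      apply: (face_free_eq yz).
  by apply: zmin; rewrite inE yG0 (Gf _ _ zG yz).
have [x i xz oz xi|x xz [y /= yG0 xy]|h [ch hW hh0]] :=
  cell_extension (@closed_cells G0) ch0 (eW z zG zG0).
- have [y [yz yz' xy]] := cell_bd B_even xz oz xi.
  have yG0 := facesG0 y yz yz'; split; first by exists y.
  by apply: (Wf y z zG yz); exact: h0W.
(* If no free coordinate of [x] were extremal, [x] would be interior to [z], so [z] would be a face
   of [y] and lie in [G0]. *)
- apply: contrapT => nx; move: zG0; apply/negP; rewrite negbK.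
  apply: (G0f _ y) => //; apply: (cell_inj_free xy xz) => i oz.
  have := xz i; rewrite oz /= le_eqVlt => /orP[/eqP xi|//].
  by case: nx; exists i.
pose G1 := z |: G0.
have cellsG1 : cells G1 = cells G0 `|` cell z.
  apply/seteqP; split=> x.
    move=> [y /=]; rewrite !inE => /orP[/eqP->|yG0] xy; [by right|left].
    by exists y.
  by move=> [[y yG0 xy]|xz]; [exists y|exists z];
      rewrite //= !inE ?eqxx ?(orbT, orTb)//; apply/orP; right.
have [|||||y x|h' [ch' h'W h'h]] := IH G1 h.
- by rewrite (leq_trans _ Gk)//; apply/proper_card/properP; split;
    [apply/fintype.subsetP => y; rewrite !inE => /andP[/norP[_ ->]]|exists z;
        rewrite !inE ?eqxx ?zG0].
- by apply/fintype.subsetP => y; rewrite !inE => /orP[/eqP->//|];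
    apply: (fintype.subsetP G0G).
- move=> y y'; rewrite !inE => /orP[/eqP-> yz|y'G0 yy'].
    by have [->|yz'] := eqVneq y z; rewrite ?eqxx// facesG0 ?orbT.
  by rewrite (G0f y y')// orbT.
- by move=> y yG; rewrite !inE => /norP[_ yG0]; exact: eW.
- by rewrite cellsG1.
- rewrite !inE => /orP[/eqP->|yG0] xy; first exact: hW.
  by rewrite hh0; [exact: h0W|exists y].
exists h'; split => // x xG0; rewrite h'h ?hh0//.
by rewrite cellsG1; left.
Qed.

End Carrier.

(** The distance [2 / n.+1] is the side of the small cubes when [[-1, 1]] is cut into [n.+1]
    parts. *)
Lemma uniform_continuity (R : realType) (E : normedModType R) (A : set E)
    (I : choiceType) (S : {fset I}) (g : I -> E -> R) (e : R) :
  compact A -> (forall i, i \in S -> {within A, continuous (g i)}) -> 0 < e ->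
  exists n : nat, forall x y, A x -> A y -> `|x - y| <= 2 / n.+1%:R ->
    forall i, i \in S -> `|g i x - g i y| < e.
Proof.
move=> /compact_near_coveringP cA cg e0.
suff [n _ nP] : \forall n \near \oo, forall i, i \in S -> A `<=`
    [set x | forall y, A x -> A y -> `|x - y| <= 2 / n.+1%:R ->
        `|g i x - g i y| < e].
  by exists n => x y Ax Ay xy i iS; apply: (nP n (leqnn n) i iS).
have : \forall n \near \oo, (\bigcap_(i in [set` S]) [set n | A `<=`
    [set x | forall y, A x -> A y -> `|x - y| <= 2 / n.+1%:R ->
        `|g i x - g i y| < e]]) n.
  apply: filter_bigI => i iS; apply: (cA nat \oo (fun n x =>
    forall y, A x -> A y -> `|x - y| <= 2 / n.+1%:R ->
        `|g i x - g i y| < e)) => x Ax.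
  have e2 : 0 < e / 2 by lra.
  have /subspace_continuousP/(_ x Ax)/cvgrPdist_lt/(_ _ e2) := cg i iS.
  rewrite near_withinE near_nbhs => /nbhs_ballP[d /= d0 dP].
  have dd : 0 < d / 2 by lra.
  have d4 : 0 < d / 4 by lra.
  have dd2 : d / 2 <= d by lra.
  (* With [1 / n.+1 < d / 4] the mesh is below [d / 2], so a point within the mesh of the ball of
     radius [d / 2] stays in the ball of radius [d]. *)
  exists (ball x (d / 2), [set n | n.+1%:R^-1 < d / 4]) => /=.
    split; first exact: nbhsx_ballx.
    exact: (near_infty_natSinv_lt (PosNum d4)).
  move=> [x' n] /= [xx' nd] y Ax' Ay x'y.
  have h1 : `|g i x - g i x'| < e / 2.
    by apply: dP => //; exact: (le_ball dd2).
  have h2 : `|g i x - g i y| < e / 2.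
    apply: dP => //; rewrite -ball_normE /= in xx' *.
    rewrite (le_lt_trans (ler_distD x' _ _))//.
    move: nd x'y; set q := n.+1%:R^-1 => nd x'y.
    lra.
  rewrite (le_lt_trans (ler_distD (g i x) _ _))// (distrC (g i x')); lra.
by apply: filterS => n nP i; exact: nP.
Qed.

(** * Gluing cones along their bases *)

Section PrismGrid.
Context (R : realType) (m n : nat).

Local Notation B := (2 * n.+1)%N.
Local Notation index := {ffun 'I_(m + 1) -> 'I_B.+1}.
Local Notation top := (@rshift m 1 ord0).
Local Notation hor := (@lshift m 1).
Implicit Types (y z t : index).

(* The cells of [cube_bd m] times [0, 2], where the cube is subdivided into
   [n.+1 ^ m] cubes. *)
Definition prism : {set index} :=
  [set z : index | [exists i : 'I_m, (z (hor i) == ord0) ||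
      (z (hor i) == ord_max)]
           && (z top <= 2)%N].

Definition prism0 : {set index} := [set z in prism | z top == ord0].

Definition bottom z : index := [ffun i => if i == top then ord0 else z i].

(** Forgets the height and turns grid coordinates in [[0, 2 * n.+1]] into points of [[-1, 1]]. *)
Definition shadow (x : 'rV[R]_(m + 1)) : 'rV[R]_m :=
  \row_i (x 0 (hor i) / n.+1%:R - 1).

Definition lift_point (x : 'rV[R]_m) (s : R) : 'rV[R]_(m + 1) :=
  row_mx (\row_i (n.+1%:R * (x 0 i + 1))) s%:M.

Lemma hor_neq_top i : (hor i == top) = false.
Proof. by rewrite eq_lrshift. Qed.

Lemma bottom_hor z i : bottom z (hor i) = z (hor i).
Proof. by rewrite ffunE hor_neq_top. Qed.

Lemma bottom_top z : bottom z top = ord0.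
Proof. by rewrite ffunE eqxx. Qed.

Lemma bottom_prism z : z \in prism -> bottom z \in prism0.
Proof.
rewrite !inE bottom_top eqxx andbT => /andP[/existsP[i zi] _].
by rewrite andbT; apply/existsP; exists i; rewrite bottom_hor.
Qed.

Lemma prism0_bottom z : z \in prism0 -> bottom z = z.
Proof.
rewrite !inE => /andP[_ /eqP z0]; apply/ffunP => i; rewrite ffunE.
by have [->|//] := eqVneq i top; rewrite z0.
Qed.

Lemma face_bottom y z : face y z -> face (bottom y) (bottom z).
Proof.
move=> /forallP yz; apply/forallP => i; rewrite !ffunE.
by case: ifP => // _; rewrite eqxx.
Qed.

Lemma face_prism y z : z \in prism -> face y z -> y \in prism.
Proof.
rewrite !inE => /andP[/existsP[i zi] z2] /forallP yz; apply/andP; split.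
  apply/existsP; exists i; have := yz (hor i); move: zi.
  by rewrite -!(inj_eq val_inj) /=; lia.
by have := yz top; rewrite -(inj_eq val_inj) /=; lia.
Qed.

Lemma face_prism0 y z : z \in prism0 -> face y z -> y \in prism0.
Proof.
move=> zp yz; move: (zp); rewrite inE => /andP[zp' z0].
rewrite inE (face_prism zp' yz) /=; move/forallP: yz => /(_ top); move: z0.
by rewrite -!(inj_eq val_inj) /=; lia.
Qed.

Lemma card_free_bottom z : (#|free (bottom z)| + odd (z top))%N = #|free z|.
Proof.
rewrite (cardsD1 top (free z)) inE addnC; congr (_ + _)%N.
apply: eq_card => i; rewrite !inE ffunE.
by have [->|] := eqVneq i top.
Qed.

Lemma odd_end (k : 'I_B.+1) : (k == ord0) || (k == ord_max) -> odd k = false.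
Proof. by case/orP => /eqP -> //; exact: oddM. Qed.

(** Two of the [m + 1] directions are not free: the height, and a horizontal one in which [z] lies
    on the boundary of the cube. *)
Lemma card_free_prism z : z \in prism -> (#|free (bottom z)| < m)%N.
Proof.
rewrite inE => /andP[/existsP[i zi] z2].
have : (#|free (bottom z)| <= #|[set~ top]%SET :\ hor i|)%N.
  apply: subset_leq_card. apply/fintype.subsetP => j; rewrite !inE ffunE.
  have [//|jt] := eqVneq j top; have [->|//] := eqVneq j (hor i).
  by rewrite odd_end.
have : #|[set~ top]%SET| = m.
  by rewrite cardsC1 card_ord addn1.
rewrite (cardsD1 (hor i)) !inE hor_neq_top /=; lia.
Qed.

Lemma shadow_bd z x : z \in prism -> cell z x -> cube_bd (shadow x).
Proof.
rewrite inE => /andP[/existsP[i zi] _] xz.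
have n0 : 0 < n.+1%:R :> R by [].
have BE : B%:R = 2 * n.+1%:R :> R by rewrite natrM.
apply/rV_norm_eq => //; split.
  move=> j; rewrite mxE; have zB : (z (hor j) <= B)%N by rewrite -ltnS.
  have : 0 <= x 0 (hor j) /\ x 0 (hor j) <= 2 * n.+1%:R.
    rewrite -BE; have := xz (hor j); case oz: (odd (z (hor j))).
      rewrite ler_distl /= => /andP[x1 x2].
      have : (1 <= z (hor j))%N /\ ((z (hor j)).+1 <= B)%N by lia.
      rewrite -!(ler_nat R) -[(z _).+1%:R]natr1 => -[z1 z2].
      move: x1 x2 z1 z2; set b : R := B%:R; set c : R :=
          (z _)%:R => x1 x2 z1 z2.
      by split; lra.
    by rewrite normr_le0 subr_eq0 => /eqP ->; rewrite ler0n ler_nat.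
  move: (x 0 (hor j)) => a [x3 x4].
  rewrite ler_norml lerBrDr addrC subrr divr_ge0//= lerBlDr ler_pdivrMr//; lra.
exists i; rewrite mxE; have := xz (hor i).
rewrite odd_end// normr_le0 subr_eq0 => /eqP ->.
case/orP: zi => /eqP -> /=; first by rewrite mul0r sub0r normrN normr1.
rewrite BE mulfK ?gt_eqF//; have -> : 2 - 1 = 1 :> R by lra.
by rewrite normr1.
Qed.

Lemma shadow_dist z (x y : 'rV[R]_(m + 1)) : cell z x -> cell z y ->
  `|shadow x - shadow y| <= 2 / n.+1%:R.
Proof.
move=> xz yz; have n0 : 0 < n.+1%:R :> R by [].
apply/rV_norm_le => [|i]; first by rewrite divr_ge0.
rewrite !mxE; set a := x 0 _; set b := y 0 _.
have -> : a / n.+1%:R - 1 - (b / n.+1%:R - 1) = (a - b) / n.+1%:R.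
  by rewrite mulrBl opprB addrA subrK.
rewrite normrM normfV (ger0_norm (ltW n0)) ler_pM2r ?invr_gt0//.
have := xz (hor i); have := yz (hor i); rewrite -/a -/b.
rewrite !ler_distl; set c := (z _)%:R.
have : ((odd (z (hor i)))%:R : R) <= 1 by case: odd; rewrite ?ler01.
by move: (_%:R) => o; lra.
Qed.

Lemma continuous_shadow A : {within A, continuous shadow}.
Proof.
apply: continuous_row => i.
apply: (@eq_within_continuous _ _ _
    (fun x : 'rV[R]_(m + 1) => x 0 (hor i) * n.+1%:R^-1 - 1)).
  by move=> x _; rewrite mxE.
apply: within_continuousB; last exact: within_continuous_cst.
apply: within_continuousM; last exact: within_continuous_cst.
by apply: continuous_subspaceT => x; exact: coord_continuous.
Qed.

Lemma continuous_lift_point (E : topologicalType) (A : set E) (f : E ->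
    'rV[R]_m) (s : E -> R) :
  {within A, continuous f} -> {within A, continuous s} ->
  {within A, continuous (fun p => lift_point (f p) (s p))}.
Proof.
move=> cf cs; apply: continuous_row => i; case: (split_ordP i) => j ->.
  apply: (@eq_within_continuous _ _ _ (fun p => n.+1%:R * (f p 0 j + 1))).
    by move=> x _; rewrite row_mxEl mxE.
  apply: within_continuousM; first exact: within_continuous_cst.
  apply: within_continuousD; last exact: within_continuous_cst.
  apply: (@within_continuous_comp _ _ _ _ setT f
      (fun y : 'rV[R]_m => y 0 j)) => //.
  by apply: continuous_subspaceT => x; exact: coord_continuous.
apply: (@eq_within_continuous _ _ _ s) => //.
by move=> x _; rewrite row_mxEr mxE !ord1 eqxx.
Qed.

Lemma lift_pointK x s : shadow (lift_point x s) = x.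
Proof.
apply/rowP => i; rewrite mxE row_mxEl mxE mulrAC divff ?mul1r ?addrK//.
Qed.

(** The two ends must receive their vertex indices and not an adjacent interval, because [prism]
    recognizes boundary cells by the indices [ord0] and [ord_max]. *)
Lemma coord_cell (a : R) : 0 <= a <= B%:R ->
  exists k : 'I_B.+1, [/\ `|a - k%:R| <= (odd k)%:R, a = 0 -> k = ord0 &
    a = B%:R -> k = ord_max].
Proof.
have n0 : 0 < n.+1%:R :> R by [].
have B0 : B%:R != 0 :> R by rewrite pnatr_eq0.
move=> /andP[a0 aB]; have [->|an0] := eqVneq a 0.
  by exists ord0; rewrite subrr normr0; split => // /esym/eqP;
      rewrite (negbTE B0).
have [->|anB] := eqVneq a B%:R.
  exists ord_max; rewrite subrr normr0; split => // /eqP.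
  by rewrite (negbTE B0).
have a2 : 0 <= a / 2 by rewrite divr_ge0.
have /andP[q1 q2] := truncn_itv a2; set q := Num.truncn _ in q1 q2.
have aB' : a < B%:R by rewrite lt_neqAle anB.
have qB : ((q * 2).+1 < B.+1)%N.
  rewrite ltnS -(ltr_nat R) natrM; lra.
exists (Ordinal qB); split => /=; last 2 first.
- by move/eqP: an0.
- by move/eqP: anB.
rewrite oddM andbF /= -[(q * 2).+1%:R]natr1 natrM ler_distl.
by move: q2; rewrite -[q.+1%:R]natr1; lra.
Qed.

Lemma lift_point_cell (x : 'rV[R]_m) (s : R) (e : 'I_B.+1) :
  cube_bd x -> (e <= 2)%N -> `|s - e%:R| <= (odd e)%:R ->
  exists z, [/\ z \in prism, z top = e & cell z (lift_point x s)].
Proof.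
move=> /rV_norm_eq[]// x1 [i xi] e2 se.
have n0 : 0 < n.+1%:R :> R by [].
have BE : B%:R = 2 * n.+1%:R :> R by rewrite natrM.
have xB j : 0 <= n.+1%:R * (x 0 j + 1) <= B%:R.
  have := x1 j; rewrite ler_norml BE => /andP[h1 h2].
  by rewrite mulr_ge0 /= ?(mulrC 2) ?ler_pM2l//; lra.
have /choice[k kP] := fun j => coord_cell (xB j).
pose z : index := [ffun j => match fintype.split j with inl j => k j | inr _ =>
    e end].
have zh j : z (hor j) = k j by rewrite ffunE (unsplitK (inl j)).
have zt : z top = e by rewrite ffunE (unsplitK (inr ord0)).
exists z; split => //.
  rewrite inE zt e2 andbT; apply/existsP; exists i; rewrite zh.
  have [_ k0 kB] := kP i; move/eqP: xi;
      rewrite eqr_norml => /andP[/orP[]/eqP xi _].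
    by rewrite kB ?eqxx ?orbT// xi BE; lra.
  by rewrite k0 ?eqxx// xi; lra.
move=> j; case: (split_ordP j) => j' ->.
  by rewrite zh row_mxEl mxE; have [] := kP j'.
by rewrite row_mxEr mxE !ord1 eqxx zt.
Qed.

End PrismGrid.

Lemma compact_cube_bd (R : realType) m : compact (@cube_bd R m).
Proof.
apply: bounded_closed_compact.
  exists 1; split; first exact: num_real.
  by move=> x x1 y; rewrite /cube_bd /= => ->; exact: ltW.
exact: (continuous_closedP _).1 (@norm_continuous _ _) _ (@closed_eq R 1).
Qed.

Section Glue.
Context (R : realType) (V : choiceType) (K : set (V -> R)) (C : set V)
    (m : nat).

(* [K] is covered by the complement [U] of the apexes and by the pairwise
   disjoint open stars of the apexes. *)
Lemma ext_glue (U := [set w | K w /\ forall v, C v -> w v < 1]) :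
  (forall w v, K w -> 0 <= w v <= 1) ->
  (forall w v v', K w -> C v -> C v' -> 0 < w v -> 0 < w v' -> v = v') ->
  (forall d, (d <= m)%N -> ext d U) ->
  (forall v d, C v -> ext d [set w | K w /\ 0 < w v]) ->
  (forall v d, C v -> (d < m)%N -> ext d [set w | K w /\ 0 < w v < 1]) ->
  ext m K.
Proof.
move=> K01 Cinj extU extV extUV f cf fK.
have [[S fS] cfv] := cf.
(* With this mesh a coordinate varies by less than 1 on a cell, so a cell that reaches an apex,
   where the coordinate is 1, stays inside its open star. *)
have [n fn] := uniform_continuity (@compact_cube_bd R m)
    (fun v (_ : v \in S) => cfv v) ltr01.
pose g (x : 'rV[R]_(m + 1)) := f (shadow n x).
have gK z x : z \in prism m n -> cell z x -> K (g x).
  by move=> zG xz; apply/fK/shadow_bd/xz.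
have gpos z x y v : z \in prism m n -> cell z x -> cell z y -> g x v = 1 ->
    0 < g y v.
  move=> zG xz yz gx.
  have vS : v \in S.
    apply: contraT => vS; move: gx; rewrite /g fS//; first by move/esym/eqP;
        rewrite oner_eq0.
    exact: shadow_bd xz.
  have := fn _ _ (shadow_bd zG xz) (shadow_bd zG yz) (shadow_dist xz yz) v vS.
  by rewrite -/(g x) -/(g y) gx ltr_distl; lra.
pose idx := {ffun 'I_(m + 1) -> 'I_(2 * n.+1).+1}.
pose hit (t : idx) v := C v /\ exists2 x, cell t x & g x v = 1.
pose hits (c : idx) v := exists t : idx,
    [/\ t \in prism0 m n, face c t & hit t v].
pose miss (c : idx) := exists t : idx,
    [/\ t \in prism0 m n, face c t & forall v, ~ hit t v].
have prism0_sub t : t \in prism0 m n -> t \in prism m n.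
  by rewrite inE => /andP[].
have hits_pos c v x : hits c v -> cell c x -> 0 < g x v.
  move=> [t [tG ct [_ [y ty gy]]]] cx.
  exact: (gpos t y x v (prism0_sub _ tG) ty (face_cell ct cx) gy).
have hits_inj c v v' : c \in prism0 m n -> hits c v -> hits c v' -> v = v'.
  move=> cG hv hv'; pose x : 'rV[R]_(m + 1) := \row_i (c i)%:R.
  have cx : cell c x by move=> i; rewrite mxE subrr normr0.
  have [t [_ _ [Cv _]]] := hv; have [t' [_ _ [Cv' _]]] := hv'.
  exact: (Cinj _ _ _ (gK c x (prism0_sub _ cG) cx) Cv Cv'
    (hits_pos _ _ _ hv cx) (hits_pos _ _ _ hv' cx)).
have hits_face c c' v : face c c' -> hits c' v -> hits c v.
  by move=> cc' [t [tG ct ht]]; exists t; split => //; exact: face_trans ct.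
have miss_face c c' : face c c' -> miss c' -> miss c.
  by move=> cc' [t [tG ct ht]]; exists t; split => //; exact: face_trans ct.
(* The conditions come from all cofaces of [c] in the base: a hit coface asks for the open star of
   its apex, a missed one for avoiding the apexes. A face has more cofaces, hence a smaller
   carrier. *)
pose W0 (c : idx) : set (V -> R) :=
    [set w | [/\ K w, forall v, hits c v -> 0 < w v &
  miss c -> forall v, C v -> w v < 1]].
(* The prism is one layer of cells thick. Only its upper end, at height 2, must land off the
   apexes. *)
pose W (z : idx) := if z (rshift m ord0) == 2 :> nat then U `&` W0 (bottom z)
    else W0 (bottom z).
have W0_face c c' : face c c' -> W0 c `<=` W0 c'.
  move=> cc' w [Kw hw mw]; split => //
      [v /(hits_face _ _ _ cc')|/(miss_face _ _ cc')].
    exact: hw.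
  exact: mw.
have W_face y z : z \in prism m n -> face y z -> W y `<=` W z.
  move=> zG yz w; have {}yz' := W0_face _ _ (face_bottom yz); rewrite /W.
  case: (eqVneq (z (rshift m ord0) : nat) 2%N) => [z2|_]; last first.
    by case: ifP => _; [move=> []|]; move=> *; exact: yz'.
  rewrite ifT; last first.
    by move/forallP: yz => /(_ (rshift m ord0));
        rewrite -(inj_eq val_inj) /= z2 /= orbF.
  by move=> [Uw /yz'].
have gW0 c x : c \in prism0 m n -> cell c x -> W0 c (g x).
  move=> cG cx; split => [|v hv|[t [tG ct nht]] v Cv].
  - exact: gK (prism0_sub _ cG) cx.
  - exact: hits_pos cx.
  have tx := face_cell ct cx.
  have /andP[_] := K01 (g x) v (gK _ _ (prism0_sub _ tG) tx).
  rewrite le_eqVlt => /orP[/eqP gx|//].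
  by case: (nht v); split => //; exists x.
have W0U c : c \in prism0 m n -> (forall v, ~ hits c v) -> W0 c = U.
  move=> cG nh; apply/seteqP; split=> w.
    move=> [Kw _ mw]; split => //; apply: mw; exists c; split => //.
      exact: face_refl.
    by move=> v hv; apply: (nh v); exists c; split => //; exact: face_refl.
  by move=> [Kw w1]; split => // v /nh.
have VU w v : K w -> C v -> 0 < w v < 1 -> U w.
  move=> Kw Cv /andP[wv0 wv1]; split => // v' Cv'.
  have /andP[_] := K01 w v' Kw; rewrite le_eqVlt => /orP[/eqP wv'|//].
  by move: wv1; rewrite (Cinj w v v' Kw Cv Cv' wv0) wv' ?ltxx ?ltr01.
have W0UV c v : c \in prism0 m n -> hits c v -> miss c ->
    W0 c = [set w | K w /\ 0 < w v < 1].
  move=> cG hv mc; have Cv : C v by have [t [_ _ []]] := hv.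
  apply/seteqP; split=> w [Kw].
    by move=> hw mw; split => //; rewrite hw// mw.
  move=> wv; split => // [v' hv'|_].
    by rewrite (hits_inj c v' v)//; case/andP: wv.
  by have [] := VU w v Kw Cv wv.
have W0V c v : c \in prism0 m n -> hits c v -> ~ miss c ->
    W0 c = [set w | K w /\ 0 < w v].
  move=> cG hv mc; apply/seteqP; split=> w.
    by move=> [Kw hw _]; split => //; exact: hw.
  by move=> [Kw wv]; split => // v' hv'; rewrite (hits_inj c v' v).
have UW0V c v : c \in prism0 m n -> hits c v ->
    U `&` W0 c = [set w | K w /\ 0 < w v < 1].
  move=> cG hv; have Cv : C v by have [t [_ _ []]] := hv.
  apply/seteqP; split=> w.
    move=> [[Kw w1] [_ hw _]]; split => //; rewrite hw//; exact: w1.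
  move=> [Kw wv]; have Uw := VU w v Kw Cv wv; split => //.
  have [mc|mc] := pselect (miss c); first by rewrite (W0UV c v).
  by rewrite (W0V c v)//; split => //; case/andP: wv.
have extW z : z \in prism m n -> z \notin prism0 m n -> ext #|free z| (W z).
  move=> zG zG0; have cG := bottom_prism zG; set c := bottom z in cG *.
  have zc := card_free_bottom z; rewrite -/c in zc.
  have cm := card_free_prism zG; rewrite -/c in cm.
  have z12 : z (rshift m ord0) != 2 :> nat -> z (rshift m ord0) = 1 :> nat.
    move: zG zG0; rewrite !inE => /andP[-> z2] /=;
        rewrite z2 /= -(inj_eq val_inj) /=.
    by lia.
  have [[v hv]|nh] := pselect (exists v, hits c v); last first.
    have -> : W z = U.
      rewrite /W -/c W0U// => [|v hv]; last by apply: nh; exists v.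
      by rewrite setIid; case: ifP.
    apply: extU; rewrite -zc; case: odd; lia.
  have Cv : C v by have [t [_ _ []]] := hv.
  rewrite /W -/c; case: ifPn => z2.
    rewrite (UW0V c v)//; apply: extUV => //.
    by rewrite -zc (eqP z2) addn0.
  have {z2} z1 := z12 z2; rewrite z1 /= in zc.
  have [mc|mc] := pselect (miss c); last by rewrite (W0V c v)//; exact: extV.
  rewrite (W0UV c v)//; apply: extUV => //.
  (* The punctured star is good only below dimension [m]. In dimension [m] the base [c] would be a
     top cell, hence its own only coface, and could not be both hit and missed. *)
  suff h : (#|free c|.+1 != m)%N.
    by rewrite -zc (addn1 #|free c|) ltn_neqAle h cm.
  apply/eqP => cm'.
  have top t : t \in prism0 m n -> face c t -> c = t.
    move=> tG ct; apply: (face_free_eq ct).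
    have := card_free_prism (prism0_sub _ tG); rewrite (prism0_bottom tG); lia.
  have [t [tG ct ht]] := hv; have [t' [t'G ct' ht']] := mc.
  by apply: (ht' v); rewrite -(top t')// (top t).
have cg : fcont (@cells R _ _ (prism0 m n)) g.
  apply: (@fcont_comp _ _ _ _ _ _ (shadow n) f _ _ cf);
      first exact: continuous_shadow.
  by move=> x [z /= zG zx]; exact: shadow_bd (prism0_sub _ zG) zx.
have gW z x : z \in prism0 m n -> cell z x -> W z (g x).
  move=> zG zx; rewrite /W (prism0_bottom zG) ifF; first exact: gW0.
  by move: zG; rewrite inE => /andP[_ /eqP ->].
have Beven : ~~ odd (2 * n.+1) by rewrite oddM.
have [|y z zG yz|y z zG yz|h [ch hW hg]] :=
  carrier_extension Beven _ _ _ W_face extW cg gW.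
- by apply/fintype.subsetP => z; exact: prism0_sub.
- exact: face_prism yz.
- exact: face_prism0 yz.
have W0K c : W0 c `<=` K by move=> w [].
have WK z : W z `<=` K.
  by rewrite /W; case: ifP => _ w; [move=> [_]|]; exact: W0K.
pose H (x : 'rV[R]_m) (t : R) := h (lift_point n x (2 * t)).
have H0 x : cube_bd x -> H x 0 = f x.
  move=> x1; have [||z [zG z0 xz]] := @lift_point_cell R m n x (2 * 0) ord0 x1.
  - by [].
  - by rewrite mulr0 subrr normr0.
  rewrite /H hg /g ?lift_pointK//; exists z => //=.
  by rewrite inE zG z0 eqxx.
have Hin (x : 'rV[R]_m) (t : R) : cube_bd x -> 0 <= t <= 1 ->
    exists2 z, z \in prism m n &
    cell z (lift_point n x (2 * t)).
  move=> x1 t01; have k1 : (1 < (2 * n.+1).+1)%N by lia.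
  have [||z [zG z0 xz]] := @lift_point_cell R m n x (2 * t) (Ordinal k1) x1.
  - by [].
  - by rewrite /= ler_distl; lra.
  by exists z.
have H1 x : cube_bd x -> U (H x 1).
  move=> x1; have k2 : (2 < (2 * n.+1).+1)%N by lia.
  have [||z [zG z0 xz]] := @lift_point_cell R m n x (2 * 1) (Ordinal k2) x1.
  - by [].
  - by rewrite /= mulr1 subrr normr0.
  by have := hW z _ zG xz; rewrite /W z0 /= => -[].
have cH : fcont ((@cube_bd R m `*` `[0, 1]) : set ('rV[R]_m * R)%type)
    (fun p => H p.1 p.2).
  apply: (@eq_fcont _ _ _ _ (h \o (fun p : 'rV[R]_m * R =>
    lift_point n p.1 (2 * p.2)))) => [//|]; apply: fcont_comp ch.
    apply: continuous_lift_point.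
      by apply: continuous_subspaceT => x; exact: cvg_fst.
    apply: within_continuousM; first exact: within_continuous_cst.
    by apply: continuous_subspaceT => x; exact: cvg_snd.
  move=> [x t] [/= x1]; rewrite in_itv /= => t01.
  by have [z zG xz] := Hin x t x1 t01; exists z.
have [||g1 [cg1 g1U g1H]] := extU m (leqnn m) (H ^~ 1).
- apply: (@eq_fcont _ _ _ _ ((fun p => H p.1 p.2) \o
    (fun x : 'rV[R]_m => (x, 1 : R)))) => [//|]; apply: fcont_comp cH.
    apply: within_continuous_pair; last exact: within_continuous_cst.
    by apply: continuous_subspaceT => x; exact: cvg_id.
  by move=> x x1; split => //=; rewrite in_itv /= ler01 lexx.
- exact: H1.
have [x t x1 t01||g2 [cg2 g2K g2H]] := @extends_homotopy _ _ m K H cH.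
- have [z zG xz] := Hin x t x1 t01; exact/(WK z)/hW.
- by exists g1; split => // x /g1U[].
by exists g2; split => // x x1; rewrite g2H// H0.
Qed.

End Glue.

(** * Order complexes in barycentric coordinates *)

Section FiniteSupportExtensions.
Context (R : realType) (V : choiceType) (W : set (V -> R)) (j : nat).

Lemma eq_extends (f f' : 'rV[R]_j -> V -> R) :
  (forall x, cube_bd x -> f x = f' x) -> extends W f -> extends W f'.
Proof.
by move=> ff' [g [cg gW gf]]; exists g; split => // x x1; rewrite gf// ff'.
Qed.

(** Coordinates live in a vector space, so segments give the homotopy as soon as they stay in
    [W]. *)
Lemma extends_line (f f1 : 'rV[R]_j -> V -> R) :
  fcont (@cube_bd R j) f -> fcont (@cube_bd R j) f1 ->
  (forall x t, cube_bd x -> 0 <= t <= 1 ->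
    W (fun v => (1 - t) * f x v + t * f1 x v)) ->
  extends W f1 -> extends W f.
Proof.
move=> cf cf1 fW ef1.
pose H (x : 'rV[R]_j) (t : R) v := (1 - t) * f x v + t * f1 x v.
have H0 x : H x 0 = f x by apply/funext => v;
    rewrite /H subr0 mul1r mul0r addr0.
have H1 x : H x 1 = f1 x by apply/funext => v;
    rewrite /H subrr mul1r mul0r add0r.
apply: (@eq_extends (H ^~ 0)) => [x _|]; first exact: H0.
apply: extends_homotopy => //; last by apply: eq_extends ef1 => x _; rewrite H1.
have c1 : {within ((@cube_bd R j `*` `[0, 1]) : set ('rV[R]_j * R)%type),
    continuous (fun p : 'rV[R]_j * R => p.1)}.
  by apply: continuous_subspaceT => p; exact: cvg_fst.
have c2 : {within ((@cube_bd R j `*` `[0, 1]) : set ('rV[R]_j * R)%type),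
    continuous (fun p : 'rV[R]_j * R => p.2)}.
  by apply: continuous_subspaceT => p; exact: cvg_snd.
have cfst g : fcont (@cube_bd R j) g -> fcont ((@cube_bd R j `*` `[0, 1]) :
    set ('rV[R]_j * R)%type) (fun p => g p.1).
  move=> cg; apply: (@eq_fcont _ _ _ _ (g \o (fun p : 'rV[R]_j * R => p.1))) =>
      //.
  by apply: fcont_comp cg => // p [].
apply: (@fcontD _ _ _ _ (fun (p : 'rV[R]_j * R) v => (1 - p.2) * f p.1 v)
  (fun p v => p.2 * f1 p.1 v)).
  apply: (@fcontM _ _ _ _ (fun p : 'rV[R]_j * R => 1 - p.2)
      (fun p v => f p.1 v)); last exact: cfst.
  by apply: within_continuousB => //; exact: within_continuous_cst.
by apply: (@fcontM _ _ _ _ (fun p : 'rV[R]_j * R => p.2)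
    (fun p v => f1 p.1 v)) => //; exact: cfst.
Qed.

Lemma extends_cst (w : V -> R) (S : {fset V}) :
  (forall v, v \notin S -> w v = 0) -> W w -> extends W (fun _ : 'rV[R]_j => w).
Proof. by move=> wS Ww; exists (fun=> w); split => //; exact: fcont_cst wS. Qed.

End FiniteSupportExtensions.

Lemma sum_pred1_fset (R : pzRingType) (V : choiceType) (S : {fset V}) (v : V)
    (F : V -> R) :
  v \in S -> \sum_(u <- S) (v == u)%:R * F u = F v.
Proof.
move=> vS; rewrite (big_fsetD1 v)//= eqxx mul1r big_seq big1 ?addr0// => u.
by rewrite !inE eq_sym => /andP[/negbTE-> _]; rewrite mul0r.
Qed.

Lemma psumr_gt0 (R : numDomainType) (I : eqType) (s : seq I) (F : I -> R) :
  (forall i, 0 <= F i) -> 0 < \sum_(i <- s) F i -> exists2 i, i \in s & 0 < F i.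
Proof.
move=> F0 sF; apply: contrapT => nF; move: sF;
    rewrite big_seq big1 ?ltxx// => i si.
by apply/eqP; apply: contrapT => Fi; apply: nF; exists i;
    rewrite // lt0r F0 andbT; exact/negP.
Qed.

Section Delta.
Context (R : realType) (d : Order.disp_t) (L : porderType d).
Implicit Types (A : set L) (w : L -> R) (S : {fset L}).

(** The points of the realization of [order_complex A], as bare coordinate functions. *)
Definition Delta A : set (L -> R) :=
  \bigcup_(s in finite_chains A) @simplex R L s.

Lemma sum_fset_support S S' w : (forall v, v \notin S -> w v = 0) ->
  (forall v, v \notin S' -> w v = 0) -> \sum_(v <- S) w v = \sum_(v <- S') w v.
Proof.
have sub T T' : (T `<=` T')%fset -> (forall v, v \notin T -> w v = 0) ->
    \sum_(v <- T) w v = \sum_(v <- T') w v.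
  by move=> TT' wT; apply: big_fset_incl => // v _; exact: wT.
move=> wS wS'; rewrite (sub S (S `|` S')%fset) ?fsubsetUl//.
by rewrite -(sub S')// fsubsetUr.
Qed.

(* Membership in [Delta A] of a finitely supported [w], without naming the
   chain that carries it. *)
Lemma DeltaP A S w : (forall v, v \notin S -> w v = 0) ->
  Delta A w <-> [/\ forall v, 0 <= w v, \sum_(v <- S) w v = 1,
    forall v, 0 < w v -> A v &
    forall u v, 0 < w u -> 0 < w v -> (u >=< v)%O].
Proof.
move=> wS; split=> [[s [sA sc] [w0 ws w1]]|[w0 w1 wA wc]].
  have pos v : 0 < w v -> v \in s.
    by apply: contraTT => /ws ->; rewrite ltxx.
  split => // [|v /pos/sA//|u v /pos us /pos vs]; last exact: sc.
  by rewrite (sum_fset_support wS ws).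
pose s := [fset v in S | 0 < w v]%fset.
have ws v : v \notin s -> w v = 0.
  rewrite !inE /= negb_and => /orP[/wS//|].
  by rewrite lt0r w0 andbT negbK => /eqP.
have pos v : v \in s -> 0 < w v by rewrite !inE => /andP[].
exists s; last by split => //; rewrite -(sum_fset_support wS ws).
by split=> [v /pos/wA//|u v /pos ? /pos ?]; exact: wc.
Qed.

Lemma Delta_finite A w : Delta A w -> exists S, forall v, v \notin S -> w v = 0.
Proof. by move=> [s _ [_ ws _]]; exists s. Qed.

Lemma Delta_ge0 A w v : Delta A w -> 0 <= w v.
Proof. by move=> [s _ []]. Qed.

Lemma Delta_le1 A w v : Delta A w -> w v <= 1.
Proof.
move=> [s _ [w0 ws w1]]; have [vs|/ws->//] := boolP (v \in s).
by rewrite -w1 (big_fsetD1 v)//= lerDl sumr_ge0.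
Qed.

Lemma Delta_mem A w v : Delta A w -> 0 < w v -> A v.
Proof.
move=> [s [sA _] [_ ws _]] wv; apply: sA; apply: contraTT wv => /ws ->.
by rewrite ltxx.
Qed.

Lemma Delta_comparable A w u v : Delta A w -> 0 < w u -> 0 < w v -> (u >=< v)%O.
Proof.
move=> [s [_ sc] [_ ws _]] wu wv; apply: sc.
  by apply: contraTT wu => /ws ->; rewrite ltxx.
by apply: contraTT wv => /ws ->; rewrite ltxx.
Qed.

Lemma sub_Delta A A' w : Delta A w -> (forall v, 0 < w v -> A' v) -> Delta A' w.
Proof.
move=> Dw wA'; have [S wS] := Delta_finite Dw.
apply/(DeltaP _ wS); move/(DeltaP _ wS): Dw => [w0 w1 _ wc]; split => //.
Qed.

(** Comparability across the two supports makes their union a chain, so both points lie in one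
    simplex. *)
Lemma Delta_line A w w' t : 0 <= t <= 1 -> Delta A w -> Delta A w' ->
  (forall u v, 0 < w u -> 0 < w' v -> (u >=< v)%O) ->
  Delta A (fun v => (1 - t) * w v + t * w' v).
Proof.
move=> /andP[t0 t1] Dw Dw' ww'; have [S wS] := Delta_finite Dw.
have [S' wS'] := Delta_finite Dw'.
pose T := (S `|` S')%fset.
have wT v : v \notin T -> w v = 0 by rewrite inE => /norP[/wS].
have wT' v : v \notin T -> w' v = 0 by rewrite inE => /norP[_ /wS'].
have t1' : 0 <= 1 - t by rewrite subr_ge0.
have pos v : 0 < (1 - t) * w v + t * w' v -> 0 < w v \/ 0 < w' v.
  move=> h; have [|wv] := ltP 0 (w v); first by left.
  have [|wv'] := ltP 0 (w' v); first by right.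
  by move: h; rewrite ltNge -[leRHS]addr0 lerD// mulr_ge0_le0.
apply/(@DeltaP _ T) => [v vT|]; first by rewrite wT// wT'// !mulr0 addr0.
move/(DeltaP _ wT): (Dw) => [w0 w1 wA wc].
move/(DeltaP _ wT'): (Dw') => [w0' w1' wA' wc'].
split.
- by move=> v; rewrite addr_ge0// mulr_ge0.
- by rewrite big_split /= -!mulr_sumr w1 w1' !mulr1 subrK.
- by move=> v /pos[/wA|/wA'].
- move=> u v /pos[wu|wu] /pos[wv|wv]; [exact: wc|exact: ww'| |exact: wc'].
  by rewrite comparable_sym ww'.
Qed.

Definition dirac_fun (v : L) : L -> R := fun u => (u == v)%:R.

Lemma dirac_fun_gt0 v u : 0 < dirac_fun v u -> u = v.
Proof. by rewrite /dirac_fun; case: eqP; rewrite ?ltxx. Qed.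

Lemma dirac_fun_support v u : u \notin [fset v]%fset -> dirac_fun v u = 0.
Proof. by rewrite inE /dirac_fun => /negbTE->. Qed.

Lemma Delta_dirac A v : A v -> Delta A (dirac_fun v).
Proof.
move=> Av; apply/(DeltaP _ (@dirac_fun_support v)); split.
- by move=> u; rewrite /dirac_fun ler0n.
- by rewrite big_seq_fset1 /dirac_fun eqxx.
- by move=> u /dirac_fun_gt0 ->.
- by move=> u u' /dirac_fun_gt0 -> /dirac_fun_gt0 ->; exact: comparablexx.
Qed.

End Delta.

(** * Contraction by a monotone map above the identity *)

Section Contraction.
Context (R : realType) (d : Order.disp_t) (L : porderType d).
Implicit Types (A : set L) (w : L -> R) (S : {fset L}).

(* The homotopy from the identity to [j]: at time [t], the mass [t] carried by
   the topmost elements of the chain has been moved by [j], so that below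
   a moved element all elements are still in place. *)
Section Prism.
Context (j : L -> L) (S : {fset L}).

Definition mass_above w v : R := \sum_(u <- S) (v < u)%O%:R * w u.

(** Lay the masses of the chain end to end on [[0, 1]], topmost element first: this is the length of
    the part of the segment of [v] that lies before [t]. *)
Definition moved w (t : R) v : R :=
    Num.min (w v) (Num.max 0 (t - mass_above w v)).

Definition prism_homotopy w (t : R) u : R :=
  \sum_(v <- S) ((v == u)%:R * (w v - moved w t v) +
      (j v == u)%:R * moved w t v).

Context (A : set L) (w : L -> R).
Hypothesis wS : forall v, v \notin S -> w v = 0.
Hypothesis Aw : Delta A w.

Lemma mass_above_ge0 v : 0 <= mass_above w v.
Proof. by apply: sumr_ge0 => u _;
    rewrite mulr_ge0 ?ler0n// (Delta_ge0 _ Aw). Qed.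

Lemma moved_ge0 t v : 0 <= moved w t v.
Proof. by rewrite le_min (Delta_ge0 _ Aw) le_max lexx. Qed.

Lemma moved_le t v : moved w t v <= w v.
Proof. by rewrite ge_min lexx. Qed.

Lemma mass_above_lt u v : (u < v)%O -> mass_above w v + w v <= mass_above w u.
Proof.
move=> uv; have [vS|vS] := boolP (v \in S).
  rewrite -(sum_pred1_fset w vS) -big_split /=; apply: ler_sum => x _.
  rewrite -mulrDl ler_wpM2r ?(Delta_ge0 _ Aw)//.
  have [<-|_] := eqVneq v x; first by rewrite ltxx uv add0r.
  by rewrite addr0; case vx: (v < x)%O; rewrite ?ler0n// (lt_trans uv vx).
rewrite wS// addr0; apply: ler_sum => x _.
rewrite ler_wpM2r ?(Delta_ge0 _ Aw)//.
by case vx: (v < x)%O; rewrite ?ler0n// (lt_trans uv vx).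
Qed.

Lemma mass_above_le1 v : mass_above w v + w v <= 1.
Proof.
have [w0 w1 _ _] := (DeltaP A wS).1 Aw.
have [vS|vS] := boolP (v \in S).
  rewrite -(sum_pred1_fset w vS) -big_split /= -[leRHS]w1;
      apply: ler_sum => x _.
  rewrite -mulrDl ler_piMl//.
  have [<-|_] := eqVneq v x; first by rewrite ltxx add0r lexx.
  by rewrite addr0; case: (v < x)%O; rewrite ?lexx ?ler01.
rewrite wS// addr0 -[leRHS]w1; apply: ler_sum => x _; rewrite ler_piMl//.
by case: (v < x)%O; rewrite ?lexx ?ler01.
Qed.

Lemma moved0 v : moved w 0 v = 0.
Proof.
rewrite /moved sub0r (max_idPl _) ?oppr_le0 ?mass_above_ge0//.
by apply/min_idPr; exact: Delta_ge0 Aw.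
Qed.

Lemma prism_homotopy0 u : prism_homotopy w 0 u = w u.
Proof.
rewrite /prism_homotopy.
under eq_bigr do rewrite moved0 subr0 mulr0 addr0.
have [uS|uS] := boolP (u \in S).
  by under eq_bigr do rewrite eq_sym; exact: sum_pred1_fset.
rewrite wS// big_seq big1// => v vS; case: eqP => [vu|]; last by rewrite mul0r.
by rewrite -vu vS in uS.
Qed.

Lemma prism_homotopy_support t u : u \notin (S `|` [fset j v | v in S])%fset ->
  prism_homotopy w t u = 0.
Proof.
rewrite inE => /norP[uS ujS]; rewrite /prism_homotopy big_seq big1// => v vS.
have /negbTE-> : v != u by apply: contraNneq uS => <-.
have /negbTE-> : j v != u by apply: contraNneq ujS => <-; rewrite in_imfset.
by rewrite !mul0r addr0.
Qed.

Lemma prism_homotopy_gt0 t u : 0 < prism_homotopy w t u ->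
  exists2 v, 0 < w v & (u = v /\ t < mass_above w v + w v) \/
    (u = j v /\ mass_above w v < t).
Proof.
move=> /psumr_gt0[v|v _ Hv].
  by rewrite addr_ge0// mulr_ge0 ?ler0n ?moved_ge0// subr_ge0 moved_le.
have wv : 0 < w v.
  rewrite lt0r (Delta_ge0 _ Aw) andbT; apply: contraTneq Hv => wv.
  have mv : moved w t v = 0 by apply/le_anti; rewrite moved_ge0 -{1}wv moved_le.
  by rewrite mv wv subrr !mulr0 addr0 ltxx.
exists v => //; move: Hv; have [vu|vu] := eqVneq v u.
  subst u; rewrite mul1r; have [jv|_] := eqVneq (j v) v; last first.
    rewrite mul0r addr0 subr_gt0 gt_min ltxx /= gt_max ltrBlDl.
    by move=> /andP[_ h]; left.
  (* When [j v = v] both terms feed the same vertex, and either alternative may be claimed,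
     according to whether [t] has passed the end of the segment of [v]. *)
  move=> _; have [h|h] := ltP t (mass_above w v + w v); [by left|right].
  by rewrite jv (lt_le_trans _ h)// ltrDl.
rewrite mul0r add0r; have [<-|_] := eqVneq (j v) u; last by rewrite mul0r ltxx.
rewrite mul1r lt_min lt_max ltxx /= subr_gt0 => /andP[_ h]; by right.
Qed.

Hypothesis jA : forall v, A v -> A (j v).
Hypothesis j_mono : forall u v, A u -> A v -> (u <= v)%O -> (j u <= j v)%O.
Hypothesis j_ge : forall v, A v -> (v <= j v)%O.

Lemma prism_homotopy_Delta t : Delta A (prism_homotopy w t).
Proof.
have [w0 w1 wA wc] := (DeltaP A wS).1 Aw.
(* The case to exclude is [v < u]: mass moves from the top down, so [u] would be completely moved
   before [v] starts. *)
have unmoved_moved u v : 0 < w u -> 0 < w v -> t < mass_above w u + w u ->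
    mass_above w v < t -> (u >=< j v)%O.
  move=> wu wv tu tv; have Av := wA v wv.
  case: (comparable_ltgtP (wc u v wu wv)) => [uv|vu|->].
  - by apply: le_comparable; rewrite (le_trans (ltW uv))// j_ge.
  - have := mass_above_lt vu; lra.
  - by apply: le_comparable; rewrite j_ge.
apply/(DeltaP _ (@prism_homotopy_support t)); split.
- move=> u; apply: sumr_ge0 => v _.
  by rewrite addr_ge0// mulr_ge0 ?ler0n ?moved_ge0// subr_ge0 moved_le.
- rewrite exchange_big /= -[RHS]w1 big_seq [RHS]big_seq; apply: eq_bigr => v vS.
  have total x (c : R) : x \in (S `|` [fset j v | v in S])%fset ->
      \sum_(u <- (S `|` [fset j v | v in S])%fset) (x == u)%:R * c = c.
    exact: (sum_pred1_fset (fun=> c)).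
  rewrite big_split /= !total ?subrK// inE ?vS//.
  by rewrite in_imfset ?orbT.
- by move=> u /prism_homotopy_gt0[v /wA Av [[-> _]|[-> _]]] //; exact: jA.
- move=> u u' /prism_homotopy_gt0[v wv vP] /prism_homotopy_gt0[v' wv' vP'].
  case: vP => -[-> tv]; case: vP' => -[-> tv'].
  + exact: wc.
  + exact: unmoved_moved.
  + by rewrite comparable_sym; exact: unmoved_moved.
  + case/orP: (wc v v' wv wv') => vv'.
      by apply: le_comparable; apply: j_mono => //; exact: wA.
    by apply: ge_comparable; apply: j_mono => //; exact: wA.
Qed.

End Prism.

Lemma fcont_prism_homotopy (E : topologicalType) (D : set E) (j : L -> L) S
    (f : E -> L -> R) (t : E -> R) A :
  (forall x, D x -> forall v, v \notin S -> f x v = 0) ->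
  (forall x, D x -> Delta A (f x)) ->
  (forall v, {within D, continuous (fun x => f x v)}) ->
  {within D, continuous t} ->
  fcont D (fun x => prism_homotopy j S (f x) (t x)).
Proof.
move=> fS fA cf ct; split.
  exists (S `|` [fset j v | v in S])%fset => x Dx v.
  exact: prism_homotopy_support.
have cm v : {within D, continuous (fun x => moved S (f x) (t x) v)}.
  apply: within_continuous_min => //; apply: within_continuous_max.
    exact: within_continuous_cst.
  apply: within_continuousB => //; apply: within_continuous_sum => u.
  by apply: within_continuousM => //; exact: within_continuous_cst.
move=> u; apply: within_continuous_sum => v.
apply: within_continuousD; apply: within_continuousM => //.
- exact: within_continuous_cst.
- exact: within_continuousB.
- exact: within_continuous_cst.
Qed.

(* Quillen's criterion: [id <= j >= a] contracts [Delta A]. *)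
Lemma ext_Delta_closure A (j : L -> L) (a : L) i :
  A a -> (forall v, A v -> A (j v)) ->
  (forall u v, A u -> A v -> (u <= v)%O -> (j u <= j v)%O) ->
  (forall v, A v -> (v <= j v)%O) -> (forall v, A v -> (a <= j v)%O) ->
  ext i (@Delta R d L A).
Proof.
move=> Aa jA j_mono j_ge a_le f [[S fS] cf] fA.
pose H (x : 'rV[R]_i) (t : R) := prism_homotopy j S (f x) t.
apply: (@eq_extends _ _ _ _ (H ^~ 0)) => [x x1|].
  apply/funext => u; exact: (@prism_homotopy0 j S A (f x) (fS x x1) (fA x x1)).
have HA x t : cube_bd x -> Delta A (H x t).
  by move=> x1; apply: prism_homotopy_Delta => //; [exact: fS|exact: fA].
pose D : set ('rV[R]_i * R)%type := @cube_bd R i `*` `[0, 1].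
have c1 : {within D, continuous (fun p : 'rV[R]_i * R => p.1)}.
  by apply: continuous_subspaceT => p; exact: cvg_fst.
have c2 : {within D, continuous (fun p : 'rV[R]_i * R => p.2)}.
  by apply: continuous_subspaceT => p; exact: cvg_snd.
have cH : fcont D (fun p => H p.1 p.2).
  apply: (@fcont_prism_homotopy _ _ _ _ (fun p => f p.1) (fun p => p.2) A) =>
      //.
  - by move=> p [p1 _]; exact: fS.
  - by move=> p [p1 _]; exact: fA.
  - move=> v; apply: (@within_continuous_comp _ _ _ D (@cube_bd R i)
      (fun p => p.1) (fun x => f x v)) => //.
    by move=> p [].
have cH1 : fcont (@cube_bd R i) (H ^~ 1).
  apply: (@fcont_prism_homotopy _ _ _ _ f (fun=> 1) A) => //.
  exact: within_continuous_cst.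
apply: extends_homotopy cH _ _ => [x t x1 _|]; first exact: HA.
apply: (@extends_line _ _ _ _ _ (fun=> dirac_fun R a)) => //.
- exact: fcont_cst (@dirac_fun_support R d L a).
- move=> x t x1 t01; apply: Delta_line => //; [exact: HA|exact: Delta_dirac|].
  move=> u v Hu /dirac_fun_gt0 ->.
  (* At time 1 no mass is left in place, so the support consists of values of [j], all above [a]. *)
  have [v' wv' [[-> ]|[-> _]]] := prism_homotopy_gt0 (fA x x1) Hu.
    by have := mass_above_le1 (fS x x1) (fA x x1) v'; lra.
  by apply: ge_comparable; apply/a_le/(Delta_mem (fA x x1)).
- exact: extends_cst (@dirac_fun_support R d L a) (Delta_dirac R Aa).
Qed.

End Contraction.

(** * Stars, links and open intervals *)

Section Interval.
Context (R : realType) (disp : Order.disp_t) (L : porderType disp) (rk : L ->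
    nat).
Local Open Scope order_scope.

(** The straight line to the center [v] never lowers the coordinate at [v] to 0. *)
Lemma ext_star (A : set L) v i :
  A v -> ext i [set w | @Delta R disp L A w /\ (0 < w v)%R].
Proof.
move=> Av f cf fA; apply: (@extends_line _ _ _ _ _ (fun=> dirac_fun R v)) => //.
- exact: fcont_cst (@dirac_fun_support R disp L v).
- move=> x t x1 t01; have [Dfx fxv] := fA x x1; split.
    apply: Delta_line => //; first exact: Delta_dirac.
    by move=> u u' fu /dirac_fun_gt0 ->; exact: Delta_comparable Dfx _ _.
  case/andP: t01 => t0 t1; rewrite /dirac_fun eqxx mulr1.
  have [->|t1'] := eqVneq t 1%R; first by rewrite subrr mul0r add0r.
  by rewrite ltr_wpDr// mulr_gt0// subr_gt0 lt_neqAle t1'.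
- apply: (@extends_cst _ _ _ _ _ [fset v]%fset) => [u|].
    exact: dirac_fun_support.
  by split; [exact: Delta_dirac|rewrite /dirac_fun eqxx].
Qed.

(* An open star without its center is, up to homotopy, the link of the
   center: [w] is first moved to the points with coordinate [1 / 2] at [v]. *)
Lemma ext_punctured_star (A A' : set L) v i :
  A v -> (forall u, A' u -> A u) -> (forall u, A' u -> u >=< v) -> ~ A' v ->
  (forall u, A u -> u >=< v -> u = v \/ A' u) ->
  ext i (@Delta R disp L A') ->
  ext i [set w | @Delta R disp L A w /\ (0 < w v < 1)%R].
Proof.
move=> Av A'A A'v nA'v linkA' extA' f cf fA.
pose q x u : R := if u == v then 0%R else (f x u * (1 - f x v)^-1)%R.
have pos x u : cube_bd x -> (0 < q x u)%R -> u != v /\ (0 < f x u)%R.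
  move=> x1; rewrite /q; case: eqP => [_|uv]; first by rewrite ltxx.
  have [Df /andP[f0 f1]] := fA x x1.
  by rewrite pmulr_lgt0// invr_gt0 subr_gt0.
have qA x : cube_bd x -> Delta A' (q x).
  move=> x1; have [Df /andP[fv0 fv1]] := fA x x1.
  have [S fS] := Delta_finite Df.
  have [f0 fs1 fmem fcomp] := (DeltaP A fS).1 Df.
  have vS : v \in S by apply: contraTT fv0 => /fS ->; rewrite ltxx.
  have fv1' : (0 < 1 - f x v)%R by rewrite subr_gt0.
  apply/(@DeltaP _ _ _ _ S) => [u uS|]; first by rewrite /q fS// mul0r;
      case: ifP.
  split.
  - move=> u; rewrite /q; case: ifP => // _; apply: mulr_ge0 => //.
    by rewrite invr_ge0 ltW.
  - rewrite (big_fsetD1 v)//= {1}/q eqxx add0r.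
    have -> : (\sum_(u <- (S `\ v)%fset) q x u =
        (\sum_(u <- (S `\ v)%fset) f x u) * (1 - f x v)^-1)%R.
      rewrite mulr_suml big_seq [RHS]big_seq; apply: eq_bigr => u.
      by rewrite !inE /q => /andP[/negbTE->].
    have -> : (\sum_(u <- (S `\ v)%fset) f x u = 1 - f x v)%R.
      by move: fs1; rewrite (big_fsetD1 v)//= => <-; rewrite addrAC subrr add0r.
    by rewrite mulfV// gt_eqF.
  - move=> u /(pos _ _ x1)[/eqP uv fu].
    by case: (linkA' u (fmem u fu) (fcomp u v fu fv0)).
  - by move=> u u' /(pos _ _ x1)[_ fu] /(pos _ _ x1)[_ fu']; exact: fcomp.
have cq : fcont (@cube_bd R i) q.
  have [[S fS] cfv] := cf; split.
    by exists S => x x1 u uS; rewrite /q fS// mul0r; case: ifP.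
  move=> u; rewrite /q; case: (u == v); first exact: within_continuous_cst.
  apply: within_continuousM => //; apply: within_continuousV.
    by move=> x /fA[_ /andP[_ fv1]]; rewrite gt_eqF// subr_gt0.
  by apply: within_continuousB => //; exact: within_continuous_cst.
(* A copy of the link at the level where [v] has coordinate [1 / 2]; it lies inside the punctured
   star. *)
pose half (w : L -> R) : L -> R :=
    fun u => ((1 - 1 / 2) * dirac_fun R v u + 1 / 2 * w u)%R.
have half_A w : Delta A' w -> Delta A (half w) /\ half w v = (1 / 2)%R.
  move=> A'w; split.
    apply: Delta_line; [lra|exact: Delta_dirac|..].
      by apply: (sub_Delta A'w) => u /(Delta_mem A'w)/A'A.
    by move=> u u' /dirac_fun_gt0 -> /(Delta_mem A'w)/A'v;
        rewrite comparable_sym.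
  have wv : w v = 0%R.
    apply/le_anti; rewrite (Delta_ge0 _ A'w) andbT leNgt.
    by apply/negP => /(Delta_mem A'w).
  by rewrite /half /dirac_fun eqxx wv mulr0 addr0 mulr1; lra.
have chalf (D : set 'rV[R]_i) g : fcont D g -> fcont D (fun x => half (g x)).
  move=> cg; apply: fcontD.
    apply: fcontM; first exact: within_continuous_cst.
    exact: fcont_cst (@dirac_fun_support R disp L v).
  by apply: fcontM => //; exact: within_continuous_cst.
apply: (@extends_line _ _ _ _ _ (fun x => half (q x))) => //;
    first exact: chalf.
- move=> x t x1 /andP[t0 t1]; have [Df /andP[fv0 fv1]] := fA x x1.
  have [Dh hv] := half_A _ (qA x x1); split.
    apply: Delta_line => //; first by rewrite t0.
    move=> u u' fu; rewrite /half => hu'.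
    have fu' : (0 < f x u')%R.
      have [/dirac_fun_gt0->//|du'] := ltP 0%R (dirac_fun R v u').
      have [/(pos _ _ x1)[]//|qu'] := ltP 0%R (q x u').
      by move: hu' du' qu'; move: (q x u') (dirac_fun R v u') => a b; lra.
    exact: Delta_comparable Df _ _.
  by rewrite hv; apply/andP; split; nra.
have [g [cg gA' gq]] := extA' q cq qA.
exists (fun x => half (g x)); split.
- exact: (chalf _ g cg).
- by move=> x /gA'/half_A[Dh hv]; split; [exact: Dh|rewrite /= hv; lra].
- by move=> x /gq ->.
Qed.

(** A chain of [A] contains at most one element of [C]. If its coordinate is below 1, some mass is
    left elsewhere, and deleting the coordinate and renormalizing gives a point joined to the old
    one by a segment. *)
Lemma ext_push_off (A C : set L) i :
  (forall u v, A u -> A v -> C u -> C v -> u >=< v -> u = v) ->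
  ext i (@Delta R disp L (A `\` C)) ->
  ext i [set w | @Delta R disp L A w /\ forall v, C v -> (w v < 1)%R].
Proof.
move=> antiC extAC f cf fA; have [[S fS] cfv] := cf.
(* At most one term is nonzero, but which one depends on [x]; the sum is continuous without naming
   it. *)
pose c x : R := (\sum_(v <- S | `[< C v >]) f x v)%R.
have c1 x : cube_bd x -> (c x < 1)%R.
  move=> x1; have [Df fC] := fA x x1.
  have [[v vS /andP[/asboolP Cv fv]]|nv] :=
      pselect (exists2 v, v \in S & `[< C v >] && (0 < f x v)%R); last first.
    rewrite /c big_seq_cond big1 ?ltr01// => v /andP[vS Cv].
    apply/le_anti; rewrite (Delta_ge0 _ Df) andbT leNgt.
    by apply/negP => fv; apply: nv; exists v; rewrite ?Cv.
  suff -> : c x = f x v by exact: fC.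
  rewrite /c big_mkcond (big_fsetD1 v)//= asboolT// big_seq big1 ?addr0// => u.
  rewrite !inE => /andP[uv _]; case: asboolP => // Cu.
  apply/le_anti; rewrite (Delta_ge0 _ Df) andbT leNgt; apply/negP => fu.
  move/eqP: uv; apply; apply: antiC => //; first exact: Delta_mem Df fu.
    exact: Delta_mem Df fv.
  exact: Delta_comparable Df fu fv.
pose q x u : R := if `[< C u >] then 0%R else (f x u * (1 - c x)^-1)%R.
have pos x u : cube_bd x -> (0 < q x u)%R -> ~ C u /\ (0 < f x u)%R.
  move=> x1; rewrite /q; case: asboolP => [_|Cu]; first by rewrite ltxx.
  by rewrite pmulr_lgt0// invr_gt0 subr_gt0 c1.
have qAC x : cube_bd x -> Delta (A `\` C) (q x).
  move=> x1; have [Df fC] := fA x x1.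
  have [f0 fs1 fmem fcomp] := (DeltaP A (fS x x1)).1 Df.
  apply/(@DeltaP _ _ _ _ S) => [u uS|]; first by rewrite /q fS// mul0r;
      case: ifP.
  split.
  - move=> u; rewrite /q; case: ifP => // _; apply: mulr_ge0 => //.
    by rewrite invr_ge0 subr_ge0 ltW// c1.
  - rewrite (bigID (fun u => `[< C u >])) /= big1 ?add0r => [|u Cu];
      last by rewrite /q Cu.
    have -> : (\sum_(u <- S | ~~ `[< C u >]) q x u =
        (\sum_(u <- S | ~~ `[< C u >]) f x u) * (1 - c x)^-1)%R.
      by rewrite mulr_suml; apply: eq_bigr => u /negbTE Cu; rewrite /q Cu.
    have -> : (\sum_(u <- S | ~~ `[< C u >]) f x u = 1 - c x)%R.
      move: fs1; rewrite (bigID (fun u => `[< C u >])) /= -/(c x) => <-.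
      by rewrite addrAC subrr add0r.
    by rewrite mulfV// gt_eqF// subr_gt0 c1.
  - by move=> u /(pos _ _ x1)[Cu /fmem].
  - by move=> u u' /(pos _ _ x1)[_ fu] /(pos _ _ x1)[_ fu']; exact: fcomp.
have cq : fcont (@cube_bd R i) q.
  split; first by exists S => x x1 u uS; rewrite /q fS// mul0r; case: ifP.
  move=> u; rewrite /q; case: asboolP => _; first exact: within_continuous_cst.
  apply: within_continuousM => //; apply: within_continuousV.
    by move=> x x1; rewrite gt_eqF// subr_gt0 c1.
  apply: within_continuousB; first exact: within_continuous_cst.
  exact: within_continuous_sum.
apply: (@extends_line _ _ _ _ _ q) => //.
  move=> x t x1 t01; have [Df fC] := fA x x1; split.
    apply: Delta_line => //.
      by apply: (sub_Delta (qAC x x1)) => u /(Delta_mem (qAC x x1))[].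
    by move=> u u' fu /(pos _ _ x1)[_ fu']; exact: Delta_comparable Df fu fu'.
  move=> v Cv; rewrite /q asboolT// mulr0 addr0.
  have := fC v Cv; have := Delta_ge0 v Df; case/andP: t01; nra.
have [g [cg gAC gq]] := extAC q cq qAC.
exists g; split => // x x1; have Dg := gAC x x1; split.
  by apply: (sub_Delta Dg) => u /(Delta_mem Dg)[].
move=> v Cv; apply: (le_lt_trans _ ltr01); rewrite leNgt.
by apply/negP => /(Delta_mem Dg)[].
Qed.

Hypothesis rk_lt : forall x y : L, x < y -> (rk x < rk y)%N.
(** For flats, [a] and [j x] are the joins of [A] and of [x] with a fixed point of [B] outside
    [A]. *)
Hypothesis closure_operator : forall A B : L, A < B ->
    exists (a : L) (j : L -> L),
  [/\ A < a, rk a = (rk A).+1,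
    forall x y, A <= x -> x <= y -> y <= B -> j x <= j y &
    forall x, A <= x -> x <= B -> [/\ x <= j x, a <= j x, j x <= B,
      (rk (j x) <= (rk x).+1)%N & (a <= x -> j x = x)]].

(** The bound reads [i <= rk B - rk A - 2], the dimension of the order complex for flats. The
    induction is on [rk B] with [A] fixed, since the link of an apex [v] is the interval from [A] to
    [v]. *)
Lemma ext_interval (A B : L) i : A < B -> (rk A + i.+1 < rk B)%N ->
  ext i (@Delta R disp L [set x | A < x < B]).
Proof.
have [n] := ubnP (rk B); elim: n => // n IH in B i *.
rewrite ltnS => Bn AB iB; have [a [j [Aa rka j_mono jP]]] :=
    closure_operator AB.
have aB : a < B.
  have [_ aj jB _ _] := jP A (lexx _) (ltW AB).
  rewrite lt_neqAle (le_trans aj jB) andbT; apply/eqP => aB.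
  by move: iB; rewrite -aB rka; lia.
pose C : set L := [set x | [/\ A < x < B, (rk x).+1 = rk B & ~ a <= x]].
have comp_eq u v : u >=< v -> rk u = rk v -> u = v.
  by move=> uv ruv; case: (comparable_ltgtP uv) => // /rk_lt; lia.
apply: (@ext_glue _ _ _ C i).
- by move=> w v Dw; rewrite (Delta_ge0 v Dw) (Delta_le1 v Dw).
- move=> w v v' Dw [_ rv _] [_ rv' _] wv wv'; apply: comp_eq; last by lia.
  exact: Delta_comparable Dw wv wv'.
- move=> i' _; apply: ext_push_off.
    by move=> u v _ _ [_ ru _] [_ rv _] uv; apply: comp_eq => //; lia.
  have in_j x : ([set x | A < x < B] `\` C) x ->
      [/\ A < x, x < B & a <= x \/ ((rk x).+1 < rk B)%N].
    move=> [AxB nC]; have /andP[Ax xB] := AxB; split => //.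
    have [ax|ax] := boolP (a <= x); [by left|right].
    rewrite ltn_neqAle rk_lt// andbT; apply/eqP => rx; apply: nC; split => //.
    exact/negP.
  apply: (@ext_Delta_closure _ _ _ _ j a).
  + by split; [rewrite /= Aa aB|move=> [_ _]; rewrite lexx].
  (* [j x = B] cannot happen off the apexes: either [a <= x] and [j x = x], or [x] has corank at
     least two and [j] gains at most one. *)
  + move=> x /in_j[Ax xB xC]; have [xj aj jB rj ja] := jP x (ltW Ax) (ltW xB).
    split; last by move=> [_ _]; rewrite aj.
    rewrite /= (lt_le_trans Ax xj) /=; case: xC => [/ja->//|rx].
    rewrite lt_neqAle jB andbT; apply/eqP => jxB.
    by move: rj; rewrite jxB; lia.
  + by move=> u v /in_j[Au _ _] /in_j[_ vB _] uv; apply: j_mono => //;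
      exact: ltW.
  + by move=> x /in_j[Ax xB _]; have [] := jP x (ltW Ax) (ltW xB).
  + by move=> x /in_j[Ax xB _]; have [] := jP x (ltW Ax) (ltW xB).
- by move=> v i' [AvB _ _]; exact: ext_star.
- move=> v i' [AvB rv nav] i'i; have /andP[Av vB] := AvB.
  apply: (@ext_punctured_star _ [set x | A < x < v]) => //.
  + by move=> u /andP[Au uv]; rewrite /= Au (lt_trans uv vB).
  + by move=> u /andP[_ uv]; exact: lt_comparable.
  + by move=> /andP[_]; rewrite ltxx.
  (* An apex is one rank below [B], so no element of the open interval lies above it. *)
  + move=> u /andP[Au uB] uv; case: (comparable_ltgtP uv) => [uv'|vu|->];
      last by left.
      by right; rewrite /= Au uv'.
    by have := rk_lt vu; have := rk_lt uB; lia.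
  + by apply: IH => //; lia.
Qed.

End Interval.

(** * From coordinates to the topological realization *)

Section RealizationTopology.
Context (R : realType) (V : choiceType) (K : simplicialComplex V).
Local Notation X := (realization R K).
Local Notation crd := (@Defs.coord R V K).

Lemma coord_inj : injective crd.
Proof.
move=> [p hp] [q hq] /= pq; rewrite pq in hp *.
by rewrite (Prop_irrelevance hp hq).
Qed.

Lemma coord_ge0 (p : X) v : 0 <= crd p v.
Proof. by have [s _ []] := coordP p. Qed.

(** Each bound is required to work for all smaller values too, so that the minimum over the list
    works for every element. *)
Lemma exists_min_pos (I : eqType) (s : seq I) (P : I -> R -> Prop) :
  (forall i, i \in s -> exists2 e, 0 < e & forall e', 0 < e' <= e -> P i e') ->
  exists2 e, 0 < e & forall i, i \in s -> P i e.
Proof.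
elim: s => [|i s IH] sP; first by exists 1.
suff [e e0 eP] : exists2 e, 0 < e & forall k, k \in i :: s ->
    forall e', 0 < e' <= e -> P k e'.
  by exists e => // k /eP; apply; rewrite e0 lexx.
elim: (i :: s) sP => {i s IH} [|i s IH] sP; first by exists 1.
have [k ks|e e0 eP] := IH; first by apply: sP; rewrite inE ks orbT.
have [d d0 dP] := sP i (mem_head _ _).
exists (Num.min e d); first by rewrite lt_min e0.
move=> k; rewrite inE => /predU1P[->|ks] e' /andP[e'0].
  by rewrite le_min => /andP[_ e'd]; apply: dP; rewrite e'0.
by rewrite le_min => /andP[e'e _]; apply: eP => //; rewrite e'0.
Qed.

Lemma continuous_coord v : continuous (fun p : X => crd p v).
Proof.
apply/continuousP => O oO; suff : realization_open
    ((fun p : X => crd p v) @^-1` O) by [].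
move=> s Ks p ps Op; have [vs|vs] := boolP (v \in s); last first.
  exists 1 => // q [_ qs _] _; rewrite /= qs//.
  by case: ps => [_ ps _]; move: Op; rewrite /= ps.
have /nbhs_ballP[e e0 eO] : nbhs (crd p v) O by exact: open_nbhs_nbhs.
by exists e => // q qs pq; apply: eO; exact: pq.
Qed.

(* Points of a compact set with infinitely many vertices in their supports
   would yield an infinite closed discrete subset. *)
Lemma compact_support (E : topologicalType) (D : set E) (f : E -> X) :
  compact D -> {within D, continuous f} ->
  exists S : {fset V}, forall x, D x -> forall v, v \notin S -> crd (f x) v = 0.
Proof.
move=> cD /subspace_continuousP cf.
pose Q v x := D x /\ crd (f x) v != 0.
have [[x0 _]|nD] := pselect (exists x, D x); last first.
  by exists fset0 => x Dx; case: nD; exists x.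
have /choice[xv xvP] : forall v, exists y, (exists x, Q v x) -> Q v y.
  move=> v; have [[y Qy]|nQ] := pselect (exists x, Q v x).
    by exists y.
  by exists x0.
pose U (F : {fset V}) : set X :=
  [set p | forall v, v \notin F -> (exists x, Q v x) -> p <> f (xv v)].
have oU F : open (U F).
  suff : realization_open (U F) by [].
  move=> s Ks p ps Up.
  (* A witness [f (xv v)] lying in the simplex [s] has [v] among the vertices of [s], so each
     simplex meets only finitely many witnesses. *)
  have [v vs|e e0 eP] := @exists_min_pos _ (enum_fset s) (fun v e =>
      p <> f (xv v) -> simplex s (f (xv v)) ->
      exists2 u, u \in s & e <= `|crd p u - crd (f (xv v)) u|).
    have [pv|pv] := pselect (p = f (xv v)); first by exists 1.
    have [sv|sv] := pselect (simplex s (f (xv v))); last by exists 1.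
    have [u us pu] : exists2 u, u \in s & crd p u != crd (f (xv v)) u.
      apply: contrapT => nu; apply: pv; apply: coord_inj; apply/funext => u.
      have [us|us] := boolP (u \in s).
        by apply/eqP; apply: contrapT => /negP pu; apply: nu; exists u.
      by case: ps => _ -> // _; case: sv => _ -> .
    exists `|crd p u - crd (f (xv v)) u|; first by rewrite normr_gt0 subr_eq0.
    by move=> e' /andP[_ e'e] _ _; exists u.
  exists e => // q qs pq v vF exQ qv.
  have [_ qv0] := xvP v exQ; rewrite -qv in qv0.
  have vs : v \in s.
    by apply: contraNT qv0 => vs; case: qs => _ -> .
  have [|u us] := eP v vs (Up v vF exQ); first by rewrite -qv.
  by rewrite -qv leNgt pq.
(* Compactness is used along the finite vertex sets directed by inclusion: a single [S] then has all
   [f x] in [U S], which a witness for a vertex outside [S] contradicts. *)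
pose G : set_system {fset V} :=
    filter_from setT (fun F0 => [set F | (F0 `<=` F)%fset]).
have GF : Filter G.
  apply: filter_from_filter; first by exists fset0.
  move=> F1 F2 _ _; exists (F1 `|` F2)%fset => // F /= FF.
  by split; apply: fsubset_trans FF; [exact: fsubsetUl|exact: fsubsetUr].
have U_sub F F' : (F `<=` F')%fset -> U F `<=` U F'.
  by move=> /fsubsetP FF' p Up v vF'; apply: Up; apply: contraNN vF' => /FF'.
have [|S _ SP] := (compact_near_coveringP D).1 cD _ G (fun F x => D x ->
    U F (f x)) GF.
  move=> x Dx; have [s Ks [_ sx _]] := coordP (f x).
  have Us : U s (f x).
    move=> v vs exQ fv; have [_] := xvP v exQ; rewrite -fv.
    by rewrite sx ?eqxx.
  have : within D (nbhs x) (f @^-1` U s) by apply: cf => //;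
      exact: open_nbhs_nbhs.
  move=> nx; exists ([set y | D y -> U s (f y)], [set F | (s `<=` F)%fset]) =>
      /=.
    by split => //; exists s.
  by move=> [y F] /= [yU sF] Dy; exact: U_sub sF _ (yU Dy).
exists S => x Dx v vS; apply/eqP; apply: contrapT => /negP fv.
have exQ : exists x, Q v x by exists x.
have [Dv _] := xvP v exQ.
exact: (SP S (fsubset_refl S) (xv v) Dv Dv v vS exQ).
Qed.

Lemma fcont_coord (E : topologicalType) (D : set E) (f : E -> X) :
  compact D -> {within D, continuous f} -> fcont D (fun x => crd (f x)).
Proof.
move=> cD cf; split; first exact: compact_support cD cf.
move=> v; apply: (@within_continuous_comp _ _ _ D setT f
    (fun p : X => crd p v)) => //.
by apply: continuous_subspaceT; exact: continuous_coord.
Qed.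

(** Only the finitely many simplices with vertices in [S] matter, so one radius serves them all.
    Near [x] positive coordinates stay positive, so the simplex [t] carrying [f y] also contains
    [f x], and openness is tested inside [t]. *)
Lemma continuous_realization (E : topologicalType) (D : set E) (f : E -> X) :
  fcont D (fun x => crd (f x)) -> {within D, continuous f}.
Proof.
move=> [[S fS] cf]; apply/subspace_continuousP => x Dx U.
rewrite nbhsE => -[N [oN Nx] NU]; apply: (filterS NU).
have rN : realization_open N by exact: oN.
have [t tS|e e0 eP] := @exists_min_pos _ (enum_fset (fpowerset S)) (fun t e =>
    faces K t -> simplex t (f x) -> forall q : X, simplex t q ->
    (forall v, v \in t -> `|crd (f x) v - crd q v| < e) -> N q).
  have [Kt|nKt] := pselect (faces K t); last by exists 1.
  have [tx|ntx] := pselect (simplex t (f x)); last by exists 1.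
  have [e e0 eN] := rN t Kt (f x) tx Nx.
  exists e => // e' /andP[_ e'e] _ _ q qt qx; apply: eN => // v vt.
  by rewrite (lt_le_trans (qx v vt)).
have near_dist v : within D (nbhs x) [set y | `|crd (f x) v - crd (f y) v| < e].
  move/subspace_continuousP: (cf v) => /(_ x Dx)/cvgrPdist_lt/(_ e e0).
  by [].
have near_pos v : within D (nbhs x) [set y | 0 < crd (f x) v ->
    0 < crd (f y) v].
  have [fv|fv] := ltP 0 (crd (f x) v); last first.
    by apply: filterE => y.
  move/subspace_continuousP: (cf v) => /(_ x Dx)/cvgrPdist_lt/(_ _ fv).
  by apply: filterS => y /=; rewrite ltr_distl -ltrBlDr subrr => /andP[_].
have : within D (nbhs x) (\bigcap_(v in [set` S])
    ([set y | `|crd (f x) v - crd (f y) v| < e] `&`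
    [set y | 0 < crd (f x) v -> 0 < crd (f y) v])).
  by apply: filter_bigI => v _; apply: filterI.
rewrite /within /=; apply: filterS => y yP Dy.
have [s Ks [f0 fs f1]] := coordP (f y).
pose t := [fset v in S | v \in s]%fset.
have ty v : v \notin t -> crd (f y) v = 0.
  by rewrite !inE /= negb_and => /orP[vS|/fs//]; exact: fS.
have tS : t \in fpowerset S.
  by rewrite fpowersetE; apply/fsubsetP => v; rewrite !inE => /andP[].
have Kt : faces K t.
  by apply: faces_closed Ks _; apply/fsubsetP => v; rewrite !inE => /andP[].
have tx v : v \notin t -> crd (f x) v = 0.
  move=> vt; have [vS|vS] := boolP (v \in S); last exact: fS.
  apply/le_anti; rewrite coord_ge0 andbT leNgt; apply/negP => fv.
  by have [_ /(_ fv)] := yP Dy v vS; rewrite ty// ltxx.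
have sum1 (p : X) : (forall v, v \notin t -> crd p v = 0) -> simplex t (crd p).
  move=> pt; have [s' Ks' [p0 ps p1]] := coordP p; split => //.
  rewrite -p1; have pu v : v \notin (t `|` s')%fset -> crd p v = 0.
    by rewrite inE => /norP[/pt].
  rewrite (@big_fset_incl _ _ _ _ _ (t `|` s')%fset) ?fsubsetUl//;
      last by move=> v _ /pt.
  by rewrite -(@big_fset_incl _ _ _ _ s' (t `|` s')%fset) ?fsubsetUr// =>
      v _ /ps.
apply: (eP t tS Kt (sum1 _ tx) (f y) (sum1 _ ty)) => v.
by rewrite !inE => /andP[vS _]; have [] := yP Dy v vS.
Qed.

End RealizationTopology.

(** * Euclidean disks and cubes *)

Section SphereCube.
Context (R : realType) (k : nat).
Implicit Types x : 'rV[R]_k.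

Definition enorm x : R := Num.sqrt (\sum_(i < k) x 0 i ^+ 2).

Lemma enormZ (a : R) x : enorm (a *: x) = `|a| * enorm x.
Proof.
rewrite /enorm -(sqrtr_sqr a) -sqrtrM ?sqr_ge0//; congr Num.sqrt.
by rewrite mulr_sumr; apply: eq_bigr => i _; rewrite mxE exprMn.
Qed.

Lemma enorm_sqr_ge0 x : 0 <= \sum_(i < k) x 0 i ^+ 2.
Proof. by apply: sumr_ge0 => i _; exact: sqr_ge0. Qed.

Lemma enorm0_eq0 x : enorm x = 0 -> x = 0.
Proof.
move=> /eqP; rewrite sqrtr_eq0 => x0; apply/rowP => i; rewrite mxE.
apply/eqP; rewrite -sqrf_eq0; apply/eqP/le_anti; rewrite sqr_ge0 andbT.
apply: le_trans x0; rewrite (bigD1 i)//= lerDl.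
by apply: sumr_ge0 => j _; exact: sqr_ge0.
Qed.

Lemma enorm_ge0 x : 0 <= enorm x. Proof. exact: sqrtr_ge0. Qed.

Lemma enorm0 : enorm 0 = 0.
Proof.
by rewrite /enorm big1 ?sqrtr0// => i _; rewrite mxE expr0n.
Qed.

Lemma sphereE x : sphere x <-> enorm x = 1.
Proof.
split=> [x1|/(congr1 (fun a => a ^+ 2))]; first by rewrite /enorm x1 sqrtr1.
by rewrite sqr_sqrtr ?enorm_sqr_ge0// expr1n.
Qed.

Lemma diskE x : disk x <-> enorm x <= 1.
Proof.
rewrite /disk /= -[X in _ <-> _ <= X]sqrtr1 /enorm.
by rewrite ler_sqrt.
Qed.

Lemma continuous_enorm : continuous enorm.
Proof.
move=> x; apply: (@continuous_comp _ _ _ (fun x => \sum_(i < k) x 0 i ^+ 2)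
    Num.sqrt);
  last exact: sqrt_continuous.
have : {within setT, continuous (fun x : 'rV[R]_k => \sum_(i < k) x 0 i ^+ 2)}.
  apply: within_continuous_sum => i.
  apply: (@within_continuousM _ _ _ (fun x : 'rV[R]_k => x 0 i)
      (fun x : 'rV[R]_k => x 0 i));
    apply: continuous_subspaceT => y; exact: coord_continuous.
move=> /subspace_continuousP/(_ x I) c U /c; rewrite /nbhs /= /within /=.
by apply: filterS => y; apply.
Qed.

Lemma compact_sphere : compact (@sphere R k).
Proof.
apply: bounded_closed_compact.
  exists 1; split; first exact: num_real.
  move=> c c1 x x1; apply: le_trans (ltW c1); apply/rV_norm_le => // i.
  rewrite -[leRHS](sqrtr1 R) -sqrtr_sqr ler_sqrt//.
  rewrite -[leRHS]x1 (bigD1 i)//= lerDl.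
  by apply: sumr_ge0 => j _; exact: sqr_ge0.
have -> : @sphere R k = enorm @^-1` [set 1].
  by apply/seteqP; split=> x /sphereE.
apply: (continuous_closedP _).1; first exact: continuous_enorm.
exact: closed_eq.
Qed.

(** Rescales each ray so that the maximum norm of the image is the Euclidean norm of [x]. At the
    origin the quotient is 0 by convention, and the value is 0 anyway. *)
Definition disk_to_cube x := (enorm x / `|x|) *: x.

Lemma norm_disk_to_cube x : `|disk_to_cube x| = enorm x.
Proof.
rewrite /disk_to_cube normrZ normrM normfV normr_id ger0_norm ?enorm_ge0//.
have [->|x0] := eqVneq x 0; first by rewrite normr0 mulr0 enorm0.
by rewrite divfK// normr_eq0.
Qed.

Lemma continuous_disk_to_cube A : {within A, continuous disk_to_cube}.
Proof.
apply: continuous_subspaceT => x.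
have [->|x0] := eqVneq x 0; last first.
  apply: (@continuousZ _ _ _ (fun y : 'rV[R]_k => enorm y / `|y|) id);
    last exact: cvg_id.
  apply: (@continuousM _ _ enorm (fun y : 'rV[R]_k => `|y|^-1)).
    exact: continuous_enorm.
  by apply: continuousV; [rewrite normr_eq0|exact: norm_continuous].
(* The scaling factor need not converge at 0, but the norm of the image is [enorm y], which tends to
   0. *)
have d0 : disk_to_cube 0 = 0 by rewrite /disk_to_cube scaler0.
rewrite /prop_for /continuous_at d0.
apply: ((@cvgrPdist_lt R ('rV[R]_k : normedModType R) _ (nbhs (0 : 'rV[R]_k))
    _ disk_to_cube 0).2 _) => e e0.
have : enorm y @[y --> (0 : 'rV[R]_k)] --> (0 : R).
  by rewrite -[X in _ --> X]enorm0; exact: continuous_enorm.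
move=> /cvgrPdist_lt/(_ e e0); apply: filterS => y /=.
by rewrite !sub0r !normrN norm_disk_to_cube ger0_norm// enorm_ge0.
Qed.

Lemma ext_extends_sphere (V : choiceType) (W : set (V -> R)) (f : 'rV[R]_k ->
    V -> R) :
  ext k W -> fcont (@sphere R k) f -> (forall x, sphere x -> W (f x)) ->
  exists g, [/\ fcont (@disk R k) g, forall x, disk x -> W (g x) &
    forall x, sphere x -> g x = f x].
Proof.
move=> extW cf fW; pose p x := (enorm x)^-1 *: x.
have pS x : cube_bd x -> sphere (p x).
  move=> x1; apply/sphereE; rewrite enormZ ger0_norm ?invr_ge0 ?enorm_ge0//.
  rewrite mulVf//; apply/eqP => /enorm0_eq0 x0; move: x1.
  by rewrite /cube_bd /= x0 normr0 => /esym/eqP; rewrite oner_eq0.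
have [||g [cg gW gf]] := extW (f \o p).
- apply: fcont_comp cf => //; apply: within_continuousZ.
    apply: within_continuousV; last by apply: continuous_subspaceT;
        exact: continuous_enorm.
    move=> x x1; apply/eqP => /enorm0_eq0 x0; move: x1.
    by rewrite /cube_bd /= x0 normr0 => /esym/eqP; rewrite oner_eq0.
  by apply: continuous_subspaceT => x; exact: cvg_id.
- by move=> x /pS; exact: fW.
exists (g \o disk_to_cube); split.
- apply: fcont_comp cg; first exact: continuous_disk_to_cube.
  by move=> x /diskE x1; rewrite /cube /= norm_disk_to_cube.
- by move=> x /diskE x1; apply: gW; rewrite /cube /= norm_disk_to_cube.
- move=> x /sphereE x1; rewrite /= gf;
    last by rewrite /cube_bd /= norm_disk_to_cube.
  congr f; rewrite /p /disk_to_cube enormZ x1 mulr1 div1r normfV normr_id invrK.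
  rewrite scalerA mulfV ?scale1r// normr_eq0; apply: contra_eq_neq x1 => ->.
  by rewrite enorm0 eq_sym oner_eq0.
Qed.

End SphereCube.

Lemma n_connected_order_complex (R : realType) (d : Order.disp_t)
    (L : porderType d) (A : set L) (n : int) :
  (forall i : nat, i%:Z <= n + 1 -> ext i (@Delta R d L A)) ->
  n_connected R n (realization R (order_complex A)).
Proof.
move=> extA; split.
  (* The space of rows of length 0 has only the point 0, so the boundary of the 0-cube is empty and
     [ext 0] produces a point. *)
  move=> n1; have [|||g [_ gA _]] := extA 0%N _ (fun=> fun=> 0).
  - by rewrite -lerBlDr sub0r.
  - exact: (@fcont_cst _ _ _ _ fset0).
  - move=> x; rewrite /cube_bd /= => x1.
    have [|i _] := @rV_norm_coord R 0 x; last by case: i.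
    by rewrite x1 oner_eq0.
  by constructor; apply: (Realization (coord := g 0)); apply: gA;
      rewrite /cube /= normr0.
move=> k kn f cf.
have [|||g [cg gA gf]] := @ext_extends_sphere R k.+1 L (@Delta R d L A)
    (fun x => @Defs.coord R L _ (f x)).
- by apply: extA; rewrite -[k.+1]addn1 PoszD lerD2r.
- by apply: fcont_coord => //; exact: compact_sphere.
- by move=> x _; exact: (Defs.coordP (f x)).
have /choice[G GP] : forall x : 'rV[R]_k.+1, exists p : realization R
    (order_complex A),
    disk x -> @Defs.coord R L _ p = g x.
  (* Outside the disk any value will do; [f x] provides one. *)
  move=> x; have [Dx|nDx] := pselect (disk x); last by exists (f x).
  by exists (@Realization R L (order_complex A) _ (gA x Dx)).
exists G.
  by apply: continuous_realization; apply: eq_fcont cg => x /GP ->.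
move=> x x1; apply: coord_inj; rewrite GP ?gf//.
by apply/diskE; rewrite (sphereE x).1.
Qed.

(** * Ranked posets with closure operators *)

Section RankedPoset.
Context (disp : Order.disp_t) (L : tbPOrderType disp) (rk : L -> nat).
Local Open Scope order_scope.
Hypothesis rk_lt : forall x y : L, x < y -> (rk x < rk y)%N.

Lemma rk_comparable_inj (x y : L) : x >=< y -> rk x = rk y -> x = y.
Proof.
move=> xy rxy; case: (comparable_ltgtP xy) => // /rk_lt; by rewrite rxy ltnn.
Qed.

(** [rk] is injective on a chain and takes values strictly between [rk a] and [rk b]. *)
Lemma chain_size (a b : L) (s : {fset L}) :
  finite_chains [set x | a < x < b] s -> (#|` s| <= (rk b - rk a).-1)%N.
Proof.
move=> [sab sc]; rewrite -(size_map rk) -(size_iota (rk a).+1 (rk b - rk a).-1).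
apply: uniq_leq_size.
  rewrite map_inj_in_uniq ?fset_uniq// => x y xs ys.
  by apply: rk_comparable_inj; exact: sc.
move=> _ /mapP[x xs ->]; rewrite mem_iota.
have /andP[/rk_lt ax /rk_lt xb] := sab x xs.
by move: ax xb; lia.
Qed.

Hypothesis rk_cover : forall x y : L, x < y ->
  exists z, [/\ x < z, z <= y & rk z = (rk x).+1].

Lemma chain_exists (a b : L) : a <= b ->
  exists2 s : {fset L}, finite_chains [set x | a < x < b] s &
    #|` s| = (rk b - rk a).-1.
Proof.
have [n] := ubnP (rk b - rk a)%N; elim: n => // n IH in a *;
    rewrite ltnS => nab ab.
have [ab1|ab1] := leqP (rk b - rk a) 1.
  exists fset0; first by split=> [x|x y]; rewrite in_fset0.
  by rewrite cardfs0; case: (rk b - rk a)%N ab1 => [|[]].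
have altb : a < b.
  by rewrite lt_neqAle ab andbT; apply: contraTneq ab1 => ->; rewrite subnn.
have [z [az zb rz]] := rk_cover altb.
have zltb : z < b.
  by rewrite lt_neqAle zb andbT; apply: contraTneq ab1 => <-; rewrite rz subSnn.
have [|s [szb sc] ss] := IH z _ zb; first by rewrite rz; lia.
exists (z |` s)%fset; last first.
  rewrite cardfsU1 ss rz; have -> : z \notin s.
    by apply/negP => /szb /andP[]; rewrite ltxx.
  by rewrite /= ; lia.
split=> [x|x y]; rewrite !inE.
  move=> /orP[/eqP->|/szb /andP[zx xb]]; first by rewrite /= az zltb.
  by rewrite /= xb (lt_trans az zx).
move=> /orP[/eqP->|xs] /orP[/eqP->|ys].
- exact: comparablexx.
- by apply: lt_comparable; have /andP[] := szb y ys.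
- by apply: gt_comparable; have /andP[] := szb x xs.
- exact: sc.
Qed.

(** Truncation makes both [a = b] and [rk b = (rk a).+1] give -1, the dimension of the complex whose
    only face is empty. *)
Lemma has_dim_interval (a b : L) : a <= b ->
  has_dim (order_complex [set x : L | a < x < b])
    (((rk b - rk a).-1)%:Z - 1)%R.
Proof.
move=> ab; rewrite /has_dim subrK; split.
  by move=> s /chain_size; rewrite lez_nat.
by have [s sc ss] := chain_exists ab; exists s => //; rewrite ss.
Qed.

Lemma maximal_chain_mem (C : set L) (x : L) : maximal_chain C ->
  (forall y, C y -> x >=< y) -> C x.
Proof.
move=> [totC maxC] xC; apply: (maxC (x |` C)) => [y z| |]; last by left.
  move=> [->|Cy] [->|Cz]; [by left| | |exact: totC].
    by apply/orP; exact: xC.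
  by apply/orP; rewrite orbC; exact: xC.
by move=> y Cy; right.
Qed.

Lemma maximal_chain_card n : rk \bot = 0%N -> rk \top = n ->
  maximal_chains_length L n.
Proof.
move=> rk0 rkn C maxC.
have botC : C \bot by apply: maximal_chain_mem => // y _;
    apply/le_comparable/le0x.
have topC : C \top by apply: maximal_chain_mem => // y _;
    apply/ge_comparable/lex1.
have compC x y : C x -> C y -> x >=< y by move=> Cx Cy; apply/orP;
    exact: maxC.1.
have rk_le x y : C x -> C y -> (rk x <= rk y)%N -> x <= y.
  move=> Cx Cy; case: (comparable_ltgtP (compC x y Cx Cy)) => // /rk_lt; lia.
apply/card_set_bijP; exists rk; split.
- move=> x Cx /=; rewrite ltnS -rkn; have := lex1 x.
  by rewrite le_eqVlt => /orP[/eqP->//|/rk_lt/ltnW].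
- move=> x y /set_mem Cx /set_mem Cy; apply: rk_comparable_inj; exact: compC.
- move=> i /=; elim: i => [|i IH] iN; first by exists \bot.
  have [x Cx rx] := IH (ltnW iN).
  have exy : exists m, `[< exists2 y, C y & rk y = m /\ (i < m)%N >].
    by exists n; apply/asboolP; exists \top => //; rewrite rkn; split.
  case: (ex_minnP exy) => _ /asboolP[y Cy [<- iy]] ymin.
  have xy : x < y.
    have xy : x <= y by apply: rk_le => //; rewrite rx; exact: ltnW.
    rewrite lt_neqAle xy andbT; apply/eqP => exy'.
    by move: iy; rewrite -exy' rx ltnn.
  (* Elements of [C] have rank at most [i], and are below [x], or rank at least that of [y], and are
     above [y]. So [z] is comparable with all of [C]. *)
  have [z [xz zy rz]] := rk_cover xy.
  exists z; last by rewrite rz rx.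
  apply: maximal_chain_mem => // t Ct; have [ti|it] := leqP (rk t) i.
    apply: ge_comparable; apply: le_trans (ltW xz); apply: rk_le => //.
    by rewrite rx.
  apply: le_comparable; apply: (le_trans zy); apply: rk_le => //.
  by apply: ymin; apply/asboolP; exists t.
Qed.

Lemma cohen_macaulay_closure_operator (R : realType) n :
  (forall A B : L, A < B -> exists (a : L) (j : L -> L),
  [/\ A < a, rk a = (rk A).+1,
    forall x y, A <= x -> x <= y -> y <= B -> j x <= j y &
    forall x, A <= x -> x <= B -> [/\ x <= j x, a <= j x, j x <= B,
      (rk (j x) <= (rk x).+1)%N & (a <= x -> j x = x)]]) ->
  rk \bot = 0%N -> rk \top = n -> cohen_macaulay_of_dim R L n.
Proof.
move=> clos rk0 rkn; split.
- move=> a b ab; exists (((rk b - rk a).-1)%:Z - 1)%R;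
    first exact: has_dim_interval.
  apply: n_connected_order_complex => i; rewrite subrK => i1.
  have iab : (rk a + i.+1 < rk b)%N by lia.
  apply: (ext_interval rk_lt clos) => //.
  rewrite lt_neqAle ab andbT; apply: contraTneq iab => ->; lia.
- exact: maximal_chain_card.
- move=> n0; have := has_dim_interval (le0x (\top : L)).
  rewrite rk0 rkn subn0; congr has_dim; lia.
Qed.

End RankedPoset.

(** * Flats *)

Section FlatsRank.
Context (X : piSpace) (r : nat).
Hypothesis hr : has_rank X r.
Implicit Types (s t : set X) (F G : flats X).
Local Open Scope card_scope.

Lemma card_setU1 s (x : X) n : s #= `I_n -> ~ s x -> (s `|` [set x]) #= `I_n.+1.
Proof.
move=> sn sx; apply/eq_cardSP; exists x; first by right.
suff -> : (s `|` [set x]) `\ x = s by [].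
apply/seteqP; split=> y; first by move=> [[//|->] /(_ erefl)].
by move=> sy; split; [left|move=> yx; apply: sx; rewrite -yx].
Qed.

Lemma indep_card s : indep X s -> exists2 n, s #= `I_n & (n <= r)%N.
Proof.
move=> /hr.1 sr; have /finite_setP[n sn] : finite_set s
    by apply/finite_set_leP; exists r.
by exists n => //; rewrite -card_le_II -(card_le_eql sn).
Qed.

Lemma indep0 : indep X set0.
Proof. by have [s si] := indep_nonempty X;
    exact: indep_subset si (sub0set _). Qed.

Definition rank_le s n : Prop := exists t, [/\ indep X t, t `<=` s & t #= `I_n].

Definition rank s : nat := \max_(n < r.+1 | `[< rank_le s n >]) n.

Lemma card_indep_le t s n : indep X t -> t `<=` s -> t #= `I_n ->
    (n <= rank s)%N.
Proof.
move=> ti ts tn; have [n' tn' n'r] := indep_card ti.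
have nn : n = n' by apply/card_eq_II; rewrite -(card_eql tn).
rewrite -ltnS -nn in n'r.
apply: (@leq_bigmax_cond _ _ (fun n : 'I_r.+1 => n : nat) (Ordinal n'r)).
by apply/asboolP; exists t.
Qed.

Lemma basis_exists s : exists t, [/\ indep X t, t `<=` s & t #= `I_(rank s)].
Proof.
have P0 : `[< rank_le s (@ord0 r) >].
  by apply/asboolP; exists set0; split;
      [exact: indep0|exact: sub0set|rewrite II0].
rewrite /rank (bigop.bigmax_eq_arg ord0)//.
by case: arg_maxnP => // n /asboolP.
Qed.

Lemma rank_le_card s n : (forall t m, indep X t -> t `<=` s -> t #= `I_m ->
    (m <= n)%N) ->
  (rank s <= n)%N.
Proof. by move=> sn; have [t [ti ts tn]] := basis_exists s;
    exact: sn ti ts tn. Qed.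

(** The matroid closure when [s] is independent. Points of [s] are listed separately because
    adjoining them leaves [s] independent. *)
Definition span s : set X := [set x | s x \/ ~ indep X (s `|` [set x])].

Lemma sub_span s : s `<=` span s. Proof. by left. Qed.

(** A larger [t] would give, by exchange, a point of [span s] that enlarges [s] independently. *)
Lemma card_indep_span s t n m : indep X s -> s #= `I_n ->
  indep X t -> t `<=` span s -> t #= `I_m -> (m <= n)%N.
Proof.
move=> si sn ti tS tm; rewrite leqNgt; apply/negP => nm.
have [x [[tx nsx] sxi]] := indep_exchange ti si tm sn nm.
by case: (tS x tx).
Qed.

(** Exchange with the larger set formed by [s] and [y] keeps enlarging [t]. Points taken from [s]
    keep [t] inside [span s], where its size is bounded by that of [s], so [y] itself is eventually
    chosen. *)
Lemma span_flat s : indep X s -> is_flat (span s).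
Proof.
move=> si; have [n sn _] := indep_card si.
move=> y t ny ti tS.
have sy : ~ s y by move=> sy; apply: ny; left.
have syi : indep X (s `|` [set y]) by apply: contrapT => h; apply: ny; right.
have sy1 := card_setU1 sn sy.
have [m tm _] := indep_card ti.
have mn := card_indep_span si sn ti tS tm.
have [k] := ubnP (n - m)%N; elim: k => // k IH in t m ti tS tm mn *.
move=> nmk; have [x [[sx tx] txi]] := indep_exchange syi ti sy1 tm mn.
case: sx => [sx|xy]; last by rewrite -xy.
have tx1 := card_setU1 tm tx.
have txS : t `|` [set x] `<=` span s.
  by move=> z [/tS//|->]; left.
have mn1 := card_indep_span si sn txi txS tx1.
have := IH _ _ txi txS tx1 mn1; rewrite subnS => IH'.
apply: (@indep_subset _ (t `|` [set x] `|` [set y])).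
  by apply: IH'; lia.
by move=> z [tz|->]; [left; left|right].
Qed.

Lemma rank_span s n : indep X s -> s #= `I_n -> rank (span s) = n.
Proof.
move=> si sn; apply/eqP; rewrite eqn_leq; apply/andP; split.
  by apply: rank_le_card => t m ti tS tm;
      exact: (card_indep_span si sn ti tS tm).
exact: (card_indep_le si (@sub_span s) sn).
Qed.

Lemma span_min s F : indep X s -> s `<=` F -> span s `<=` F.
Proof.
move=> si sF y [/sF//|nsy]; apply: contrapT => nFy; apply: nsy.
exact: (flatP nFy).
Qed.

Lemma basis_span s t : indep X t -> t `<=` s -> t #= `I_(rank s) ->
    s `<=` span t.
Proof.
move=> ti ts tn x sx; have [tx|ntx] := pselect (t x); [by left|right => txi].
have txs : t `|` [set x] `<=` s by move=> z [/ts//|->].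
by have := card_indep_le txi txs (card_setU1 tn ntx); rewrite ltnn.
Qed.

Lemma flat_leE F G : (F <= G)%O = `[< flat_set F `<=` flat_set G >].
Proof. by []. Qed.

Lemma rank_ltn F G : (F < G)%O -> (rank F < rank G)%N.
Proof.
rewrite lt_neqAle flat_leE => /andP[/eqP FG /asboolP FsubG].
have [x Gx nFx] : exists2 x, flat_set G x & ~ flat_set F x.
  apply: contrapT => nx; apply: FG; apply/flat_inj/seteqP; split=> // x Gx.
  by apply: contrapT => nFx; apply: nx; exists x.
have [t [ti tF tn]] := basis_exists F.
have ntx : ~ t x by move=> /tF.
apply: (card_indep_le (flatP nFx ti tF)); last exact: card_setU1.
by move=> z [/tF/FsubG|->].
Qed.

(** The join of [F] with a point: when [x] is new, it is the span of a basis of [F] enlarged by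
    [x]. *)
Lemma adjoin_point F (x : X) : exists G, [/\ (F <= G)%O, flat_set G x,
  forall H : flats X, (F <= H)%O -> flat_set H x -> (G <= H)%O,
  flat_set F x -> G = F & ~ flat_set F x -> rank G = (rank F).+1].
Proof.
have [Fx|nFx] := pselect (flat_set F x).
  by exists F; split.
have [t [ti tF tn]] := basis_exists F.
have txi := flatP nFx ti tF; have ntx : ~ t x by move=> /tF.
exists (Flat (span_flat txi)); split => //.
- rewrite flat_leE; apply/asboolP => y /(basis_span ti tF tn)[ty|nty].
    by left; left.
  right => h; apply: nty; apply: (indep_subset h) => z [tz|->]; last by right.
  by left; left.
- by left; right.
- move=> H; rewrite !flat_leE => /asboolP FH Hx; apply/asboolP.
  by apply: span_min => // z [/tF/FH|->].
- by move=> _; exact: (rank_span txi (card_setU1 tn ntx)).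
Qed.

Lemma flats_closure_operator (A B : flats X) : (A < B)%O ->
  exists (a : flats X) (j : flats X -> flats X),
  [/\ (A < a)%O, rank a = (rank A).+1,
    forall F G, (A <= F)%O -> (F <= G)%O -> (G <= B)%O -> (j F <= j G)%O &
    forall F, (A <= F)%O -> (F <= B)%O ->
        [/\ (F <= j F)%O, (a <= j F)%O, (j F <= B)%O,
      (rank (j F) <= (rank F).+1)%N & ((a <= F)%O -> j F = F)]].
Proof.
move=> AB; have := AB; rewrite lt_neqAle flat_leE =>
    /andP[/eqP AneB /asboolP AsubB].
have [x Bx nAx] : exists2 x, flat_set B x & ~ flat_set A x.
  apply: contrapT => nx; apply: AneB; apply/flat_inj/seteqP; split=> // x Bx.
  by apply: contrapT => nAx; apply: nx; exists x.
(* Each [j F] is the least flat above [F] containing [x], and this minimality makes the chosen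
   function monotone. *)
have /choice[j jP] := fun F => adjoin_point F x.
have jmono F G : (F <= G)%O -> (j F <= j G)%O.
  move=> FG; have [_ _ jmin _ _] := jP F; have [Gj jx _ _ _] := jP G.
  by apply: jmin => //; exact: le_trans FG Gj.
exists (j A), j; have [Aj jAx _ _ rjA] := jP A; split.
- rewrite lt_neqAle Aj andbT; apply/eqP => e; apply: nAx.
  by rewrite [in flat_set _]e.
- exact: rjA.
- by move=> F G _ FG _; exact: jmono.
move=> F AF FB; have [Fj jx jmin jF rjF] := jP F; split => //.
- exact: jmono.
- exact: jmin.
- have [Fx|/rjF->//] := pselect (flat_set F x).
  by rewrite jF.
- rewrite flat_leE => /asboolP jAF; apply: jF; exact: jAF.
Qed.

Lemma rank_loops : rank (loops X) = 0%N.
Proof.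
apply/eqP; rewrite -leqn0; apply: rank_le_card => t [//|m] ti tL.
move=> /eq_cardSP[x tx _]; case: (tL x tx).
by apply: (indep_subset ti) => _ ->.
Qed.

Lemma rank_setT : rank setT = r.
Proof.
apply/eqP; rewrite eqn_leq; apply/andP; split.
  apply: rank_le_card => t m ti _ tm; have [n tn nr] := indep_card ti.
  by rewrite (_ : m = n)//; apply/card_eq_II; rewrite -(card_eql tm).
apply: hr.2 => s si; have [n sn _] := indep_card si.
by rewrite (card_le_eql sn) card_le_II; exact: card_indep_le sn.
Qed.

End FlatsRank.

Theorem theorem3p22 (R : realType) (X : piSpace) (r : nat)
    (hr : has_rank X r) : cohen_macaulay_of_dim R (flats X) r.
Proof.
have clos := flats_closure_operator hr.
apply: (@cohen_macaulay_closure_operator _ _ (fun F : flats X => rank r F)).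
- exact: rank_ltn hr.
(* The element [a] of the closure operator is one rank above [A], and it lies below [B] because
   [j A] does. *)
- move=> A B AB; have [a [j [Aa ra _ jP]]] := clos A B AB; exists a;
    split => //.
  by have [_ aj jB _ _] := jP A (lexx _) (ltW AB); exact: le_trans aj jB.
- exact: clos.
- exact: rank_loops.
- exact: rank_setT.
Qed.
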